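(* Consider the repeated two-node game of coding with unknown adversary utility, threshold space $\Lambda_{\mathsf{DC}}=[\eta_{\min},\eta_{\max}]$ with $2\le \eta_{\min}<\eta_{\max}$, induced acceptance probability $\alpha(\eta)$, maps $F_\eta:[0,1]\to\mathbb{R}$, and induced utility $\mathsf{U}(\eta)=F_\eta(\alpha(\eta))$ of the data collector, all as defined in the context. Let $\mathsf{U}^*=\sup_{\eta\in\Lambda_{\mathsf{DC}}}\mathsf{U}(\eta)$ and $\Gamma(\eta)=\mathsf{U}^*-\mathsf{U}(\eta)$. Assume: (A1) $0\le \mathsf{U}(\eta)\le 1$ for all $\eta\in\Lambda_{\mathsf{DC}}$. (A2) $\mathcal{D}$ is a metric on $\Lambda_{\mathsf{DC}}$ with $|\mathsf{U}(\eta)-\mathsf{U}(\eta')|\le \mathcal{D}(\eta,\eta')$ for all $\eta,\eta'\in\Lambda_{\mathsf{DC}}$, and $\sup_{\eta,\eta'\in\Lambda_{\mathsf{DC}}}\mathcal{D}(\eta,\eta')\le 1$. (A3) $|F_\eta(\alpha)-F_\eta(\alpha')|\le \ell\,|\alpha-\alpha'|$ for all $\eta\in\Lambda_{\mathsf{DC}}$ and all $\alpha,\alpha'\in[0,1]$; put $\bar\ell=\max\{1,\ell\}$. (A4) The instance $(\Lambda_{\mathsf{DC}},\mathcal{D},\mathsf{U})$ has $(C_z,d_z)$-zooming dimension (with $C_z>0$, $d_z\ge 0$), meaning that for every $r\in(0,1]$ the set $\Lambda_r=\{\eta\in\Lambda_{\mathsf{DC}}: r/2<\Gamma(\eta)\le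 r\}$ can be covered by at most $C_z r^{-d_z}$ sets of $\mathcal{D}$-diameter at most $r/8$. Let $\pi_{\mathsf{Z}}$ be the policy induced by the Game-of-Coding Zooming Algorithm (described in the context), run with $\mathcal{D}$, $\ell$ and $\{F_\eta\}_{\eta\in\Lambda_{\mathsf{DC}}}$. Then for every $T\ge 2$, $$\mathsf{Reg}_T(\pi_{\mathsf{Z}})=O\Big(\big(C_z\,\bar\ell^{\,2}\ln^2 T\big)^{\frac{1}{d_z+2}}\;T^{\frac{d_z+1}{d_z+2}}\Big),$$ where $\mathsf{Reg}_T(\pi)=\mathbb{E}_\pi\big[\sum_{t=1}^T(\mathsf{U}^*-\mathsf{U}(\eta_t))\big]$ is the cumulative regret of a policy $\pi$.
   Context: **The game.** A data collector (DC) wants to estimate a real random variable $\mathbf{u}$ it cannot observe. There are two nodes. The honest node reports $\mathbf{y}_h=\mathbf{u}+\mathbf{n}_h$, where $\mathbf{n}_h$ has a known symmetric probability density (PDF) and $\Pr(|\mathbf{n}_h|>\Delta)=0$ for a known constant $\Delta$. The adversarial node reports $\mathbf{y}_a=\mathbf{u}+\mathbf{n}_a$, where $\mathbf{n}_a$ is independent of $\mathbf{u}$ and has PDF $g$ chosen by the adversary from the set $\Lambda_{\mathsf{AD}}$ of all PDFs on $\mathbb{R}$. The DC receives the two reports $\underline{\mathbf{y}}=\{\mathbf{y}_1,\mathbf{y}_2\}$ without knowing which is honest. For a threshold $\eta\in\Lambda_{\mathsf{DC}}$, the DC accepts iff $|\mathbf{y}_1-\mathbf{y}_2|\le\eta\Delta$;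 call this event $\mathcal{A}_\eta$. Let $\mathsf{PA}(g,\eta)=\Pr(\mathcal{A}_\eta)$ and $\mathsf{MMSE}(g,\eta)=\min_{\mathsf{est}:\mathbb{R}^2\to\mathbb{R}}\mathbb{E}[(\mathbf{u}-\mathsf{est}(\underline{\mathbf{y}}))^2\mid\mathcal{A}_\eta]$. **Utilities.** $\mathsf{U}_{\mathsf{DC}}(g,\eta)=\mathsf{Q}_{\mathsf{DC}}(\mathsf{MMSE}(g,\eta),\mathsf{PA}(g,\eta))$ and $\mathsf{U}_{\mathsf{AD}}(g,\eta)=\mathsf{Q}_{\mathsf{AD}}(\mathsf{MMSE}(g,\eta),\mathsf{PA}(g,\eta))$. Here $\mathsf{Q}_{\mathsf{DC}}:\mathbb{R}^2\to\mathbb{R}$ is non-increasing in its first and non-decreasing in its second argument, and $\mathsf{Q}_{\mathsf{AD}}:\mathbb{R}^2\to\mathbb{R}$ is strictly increasing in both arguments. The adversary knows both utility functions; the DC does not know $\mathsf{Q}_{\mathsf{AD}}$. **Best responses and induced quantities.** Let $\mathcal{B}^\eta=\arg\max_{g\in\Lambda_{\mathsf{AD}}}\mathsf{U}_{\mathsf{AD}}(g,\eta)$ and $\bar{\mathcal{B}}^\eta=\arg\min_{g\in\mathcal{B}^\eta}\mathsf{U}_{\mathsf{DC}}(g,\eta)$ (the sets are assumed nonempty). For each $\eta$ fix an arbitrary $g^*_\eta\in\bar{\mathcal{B}}^\eta$ and set $\alpha(\eta)=\mathsf{PA}(g^*_\eta,\eta)$, $m(\eta)=\mathsf{MMSE}(g^*_\eta,\eta)$,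 $\mathsf{U}(\eta)=\mathsf{Q}_{\mathsf{DC}}(m(\eta),\alpha(\eta))$. For $\alpha\in[0,1]$ let $c_\eta(\alpha)=\max\{\mathsf{MMSE}(g,\eta): g\in\Lambda_{\mathsf{AD}},\ \mathsf{PA}(g,\eta)\ge\alpha\}$ and $F_\eta(\alpha)=\mathsf{Q}_{\mathsf{DC}}(c_\eta(\alpha),\alpha)$. It is known that $m(\eta)=c_\eta(\alpha(\eta))$, so $\mathsf{U}(\eta)=F_\eta(\alpha(\eta))$. **Repeated interaction.** In round $t$ the DC commits to $\eta_t=\pi_t(\mathcal{H}_{t-1})$, a function of the history $\mathcal{H}_{t-1}$ of previous thresholds, reports and acceptance indicators; the sequence $\pi=(\pi_t)$ is the policy. The adversary observes $\eta_t$ and myopically plays some $g_t\in\bar{\mathcal{B}}^{\eta_t}$. The DC observes the reports and $Z_t=\mathbf{1}\{\mathcal{A}_{\eta_t}\}\in\{0,1\}$, which satisfies $\mathbb{E}[Z_t\mid\mathcal{H}_{t-1},\eta_t]=\alpha(\eta_t)$. **Game-of-Coding Zooming Algorithm.** Notation: $\Pi_{[0,1]}(x)=\min\{1,\max\{0,x\}\}$ and $\mathcal{B}_{\mathcal{D}}(v,r)=\{\eta\in\Lambda_{\mathsf{DC}}:\mathcal{D}(\eta,v)\le r\}$. The algorithm runs in phases $i=1,2,\dots$; phase $i$ lasts $2^i$ consecutive rounds. At the start of phase $i$ the active set $\mathcal{S}_i$ is empty. For an active $v$, $N_i(v)$ is the number of times $v$ has been played so far in phase $i$ and $N_i^{\mathsf{acc}}(v)$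 is the number of those plays with $Z=1$. Set $\widehat\alpha_i(v)=N_i^{\mathsf{acc}}(v)/N_i(v)$ if $N_i(v)>0$ and $\widehat\alpha_i(v)=0$ otherwise, $\widehat{\mathsf{U}}_i(v)=\Pi_{[0,1]}(F_v(\widehat\alpha_i(v)))$, and $\rho_i(v)=\bar\ell\sqrt{8i/(2+N_i(v))}$. In each round of phase $i$: (1) compute these quantities for all $v\in\mathcal{S}_i$; (2) if $\Lambda_{\mathsf{DC}}\not\subseteq\bigcup_{v\in\mathcal{S}_i}\mathcal{B}_{\mathcal{D}}(v,\rho_i(v))$, add an uncovered point to $\mathcal{S}_i$ with both counts equal to $0$ (its $\widehat{\mathsf{U}}_i$ and $\rho_i$ are given by the same formulas); (3) choose $v_i\in\arg\max_{v\in\mathcal{S}_i}\{\widehat{\mathsf{U}}_i(v)+2\rho_i(v)\}$, commit to $\eta_t=v_i$, observe $Z_t$; (4) increase $N_i(v_i)$ by $1$ and $N_i^{\mathsf{acc}}(v_i)$ by $Z_t$. *)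

(* Defs.v *)
From HB Require Import structures.
From mathcomp Require Import all_boot all_order all_algebra.
From mathcomp Require Import all_classical all_reals all_analysis.
From mathcomp Require Import measurable_realfun.
Set Implicit Arguments.
Unset Strict Implicit.
Unset Printing Implicit Defensive.
Import Order.TTheory GRing.Theory Num.Theory.
Import numFieldNormedType.Exports.
Local Open Scope classical_set_scope.
Local Open Scope ring_scope.

Record pdf (R : realType) := Pdf {
  density :> R -> R ;
  measurable_density : measurable_fun setT density ;
  density_ge0 : forall x, 0 <= density x ;
  integral_density : (\int[lebesgue_measure]_x (density x)%:E = 1)%E }.

Definition pdf_prob (R : realType) (g : pdf R) : set R -> \bar R :=
  fun V => (\int[lebesgue_measure]_(x in V) (g x)%:E)%E.

Section pdf_probability.
Variables (R : realType) (g : pdf R).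
Local Notation mu := (@lebesgue_measure R).

Let pdf0 : pdf_prob g set0 = 0%E.
Proof. by rewrite /pdf_prob integral_set0. Qed.

Let pdf_ge0 A : (0 <= pdf_prob g A)%E.
Proof. by apply: integral_ge0 => x _; rewrite lee_fin density_ge0. Qed.

Let pdf_integrable : mu.-integrable setT (EFin \o g).
Proof.
apply/integrableP; split.
  by apply/measurable_EFinP; exact: measurable_density.
under eq_integral do rewrite /= ger0_norm ?density_ge0//.
by rewrite integral_density ltry.
Qed.

Let pdf_sigma_additive : semi_sigma_additive (pdf_prob g).
Proof.
move=> /= A mA tA mUA; rewrite /pdf_prob integral_bigcup//=; last first.
  exact: (integrableS _ _ (@subsetT _ _)).
apply: is_cvg_ereal_nneg_natsum_cond => n _ _.
exact: pdf_ge0.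
Qed.

HB.instance Definition _ := isMeasure.Build _ _ _
  (pdf_prob g) pdf0 pdf_ge0 pdf_sigma_additive.

Let pdf_setT : pdf_prob g setT = 1%E.
Proof. exact: integral_density. Qed.

HB.instance Definition _ :=
  @Measure_isProbability.Build _ _ R (pdf_prob g) pdf_setT.

End pdf_probability.

(** Only the marginal of [n_h] is constrained, so the joint law of [(u, n_h)]
    is part of the data: [n_h] may or may not be independent of [u]. *)
Record game (R : realType) := Game {
  honest_law : probability (R * R)%type R ;
  honest_pdf : pdf R ;
  honest_pdf_sym : forall x, honest_pdf (- x) = honest_pdf x ;
  honest_pdfE : forall V : set R, measurable V ->
    honest_law [set w | V w.2] = pdf_prob honest_pdf V ;
  Delta : R ;
  honest_bounded : honest_law [set w | Delta < `|w.2|] = 0%E ;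
  (* the arguments are the MMSE and the acceptance probability, in this order *)
  QDC : R -> R -> R ;
  QDC_mono : forall m m' a a', m' <= m -> a <= a' -> QDC m a <= QDC m' a' ;
  QAD : R -> R -> R ;
  QAD_mono1 : forall m m' a, m < m' -> QAD m a < QAD m' a ;
  QAD_mono2 : forall m a a', a < a' -> QAD m a < QAD m a' }.

Section one_shot.
Variables (R : realType) (G : game R).
Implicit Types (g : pdf R) (eta alpha : R).

(** Outcomes are [(b, ((u, n_h), n_a))].  The fair coin [b], independent of
    everything else, says whether the first report is the honest one: this is
    how the collector is kept ignorant of the identity of the honest node. *)
Definition outcome := (bool * ((R * R) * R))%type.

Definition game_law g : probability outcome R :=
  (bernoulli_prob (2^-1 : R) \x (honest_law G \x pdf_prob g))%E.

Definition hidden (w : outcome) : R := w.2.1.1.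
Definition y_honest (w : outcome) : R := w.2.1.1 + w.2.1.2.
Definition y_adv (w : outcome) : R := w.2.1.1 + w.2.2.
Definition observed (w : outcome) : R * R :=
  if w.1 then (y_honest w, y_adv w) else (y_adv w, y_honest w).

Definition accepts eta (y : R * R) : bool := `|y.1 - y.2| <= eta * Delta G.

Definition reports_law g (V : set (R * R)) : \bar R :=
  game_law g (observed @^-1` V).

Definition PA g eta : R :=
  fine (reports_law g [set y | accepts eta y]).

(** Conditional mean square error; it is [0] by convention if [PA g eta = 0]. *)
Definition cond_mse g eta (est : R * R -> R) : \bar R :=
  (((PA g eta)^-1)%R%:E *
   \int[game_law g]_(w in [set w | accepts eta (observed w)])
     ((hidden w - est (observed w)) ^+ 2)%:E)%E.

Definition MMSE g eta : R :=
  fine (ereal_inf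
    [set cond_mse g eta est | est in [set est | measurable_fun setT est]]).

Definition UDC g eta : R := QDC G (MMSE g eta) (PA g eta).
Definition UAD g eta : R := QAD G (MMSE g eta) (PA g eta).

Definition best_response eta : set (pdf R) :=
  [set g | forall g', UAD g' eta <= UAD g eta].

Definition worst_best_response eta : set (pdf R) :=
  [set g | best_response eta g /\
           forall g', best_response eta g' -> UDC g eta <= UDC g' eta].

(** The set is bounded above, since the midpoint of two accepted reports is
    almost surely within [Delta + eta * Delta / 2] of the hidden variable; the
    supremum is the maximum whenever the latter exists. *)
Definition cfun eta alpha : R :=
  sup [set MMSE g eta | g in [set g | alpha <= PA g eta]].

Definition Ffun eta alpha : R := QDC G (cfun eta alpha) alpha.

Variable gstar : R -> pdf R.

Definition accept_prob eta : R := PA (gstar eta) eta.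
Definition induced_mmse eta : R := MMSE (gstar eta) eta.
Definition induced_utility eta : R :=
  QDC G (induced_mmse eta) (accept_prob eta).
Definition best_utility (L : set R) : R := sup (induced_utility @` L).
Definition gap (L : set R) eta : R := best_utility L - induced_utility eta.

End one_shot.

Definition is_metric_on (R : realType) (L : set R) (D : R -> R -> R) : Prop :=
  [/\ forall x y, L x -> L y -> 0 <= D x y,
      forall x y, L x -> L y -> (D x y = 0 <-> x = y),
      forall x y, L x -> L y -> D x y = D y x &
      forall x y z, L x -> L y -> L z -> D x z <= D x y + D y z].

Definition zooming_dimension (R : realType) (L : set R) (D : R -> R -> R)
    (Gamma : R -> R) (Cz dz : R) : Prop :=
  forall r, 0 < r <= 1 ->
  exists (n : nat) (A : 'I_n -> set R),
    [/\ n%:R <= Cz * r `^ (- dz),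
        forall k, A k `<=` L,
        forall k x y, A k x -> A k y -> D x y <= r / 8%:R &
        [set eta | L eta /\ r / 2%:R < Gamma eta <= r] `<=` \bigcup_k A k].

Record round (R : realType) := Round {
  threshold : R ;
  reports : R * R ;
  accepted : bool }.

(** Histories are in chronological order. *)
Definition history (R : realType) := seq (round R).
Definition policy (R : realType) := history R -> R.

(** After [t] rounds have been played, the next round belongs to phase
    [phase t], whose [2 ^ phase t] rounds are preceded by exactly
    [2 + 4 + ... + 2 ^ (phase t).-1 = phase_start t] rounds. *)
Definition phase (t : nat) : nat := trunc_log 2 t.+2.
Definition phase_start (t : nat) : nat := (2 ^ phase t - 2)%N.

Section zooming.
Variables (R : realType).
Variables (L : set R) (D : R -> R -> R) (F : R -> R -> R) (lbar : R).
Implicit Types (h : history R) (v : R).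

Definition phase_rounds h := drop (phase_start (size h)) h.
Definition plays h v : nat :=
  count (fun o => threshold o == v) (phase_rounds h).
Definition accepted_plays h v : nat :=
  count (fun o => (threshold o == v) && accepted o) (phase_rounds h).

Definition alpha_hat h v : R :=
  if (0 < plays h v)%N then (accepted_plays h v)%:R / (plays h v)%:R else 0.
Definition U_hat h v : R :=
  Num.min 1 (Num.max 0 (F v (alpha_hat h v))).
Definition radius h v : R :=
  lbar * Num.sqrt ((8 * phase (size h))%:R / (2 + plays h v)%:R).
Definition zoom_index h v : R := U_hat h v + 2%:R * radius h v.

Definition covered h (S : set R) : set R :=
  \bigcup_(v in S) [set eta | L eta /\ D eta v <= radius h v].

(** [S h] is the active set in the round following [h], after the activation
    step; [take (size h).-1 h] is [h] without its last round. *)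
Definition prior_active (S : history R -> set R) h : set R :=
  if size h == phase_start (size h) then set0 else S (take (size h).-1 h).

Definition activation (S : history R -> set R) h : Prop :=
  if `[< L `<=` covered h (prior_active S h) >] then S h = prior_active S h
  else exists v, [/\ L v, ~ covered h (prior_active S h) v &
                     S h = v |` prior_active S h].

(** The algorithm leaves open which uncovered point is activated and how ties
    are broken: every resolution, possibly depending on the whole history, is
    accounted for. *)
Definition zooming_policy (pi : policy R) : Prop :=
  exists S : history R -> set R, forall h,
    [/\ activation S h, S h (pi h) &
        forall v, S h v -> zoom_index h v <= zoom_index h (pi h)].

End zooming.

Section interaction.
Variables (R : realType) (G : game R) (gstar : R -> pdf R) (pi : policy R).
Context d (Omega : measurableType d) (P : probability Omega R).
(* [Y t] and [g t] belong to round [t.+1] of the game *)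
Variables (Y : nat -> Omega -> R * R) (g : nat -> Omega -> pdf R).

Fixpoint hist (t : nat) (w : Omega) : history R :=
  if t is s.+1 then
    let h := hist s w in
    rcons h (Round (pi h) (Y s w) (accepts G (pi h) (Y s w)))
  else [::].

Definition eta_ (t : nat) (w : Omega) : R := pi (hist t w).
Definition Z_ (t : nat) (w : Omega) : bool := accepts G (eta_ t w) (Y t w).

(** The sigma-algebra generated by the history of the first [t] rounds
    together with the threshold of the next one. *)
Definition past (t : nat) : set (set Omega) :=
  <<s [set E | exists s (B : set R),
         [/\ (s <= t)%N, measurable B & E = eta_ s @^-1` B]] `|`
      [set E | exists s (V : set (R * R)),
         [/\ (s < t)%N, measurable V & E = Y s @^-1` V]] `|`
      [set E | exists2 s, (s < t)%N & E = [set w | Z_ s w]] >>.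

(** [X'] is a version of the conditional expectation of [X] given the
    sigma-algebra [M]. *)
Definition is_cond_expectation (M : set (set Omega)) (X X' : Omega -> R) :=
  (forall B, measurable B -> M (X' @^-1` B)) /\
  (forall E, M E ->
     \int[P]_(w in E) (X' w)%:E = \int[P]_(w in E) (X w)%:E)%E.

(** The density [g t w] may be any function of the randomness, so the adversary
    may use the history or randomize among its worst best responses; given the
    past, the reports are distributed as in the one-shot game. *)
Definition repeated_game : Prop :=
  [/\ (forall t, measurable_fun setT (Y t)) /\
      (forall t, measurable_fun setT (eta_ t)),
      forall t w, worst_best_response G (eta_ t w) (g t w),
      forall t V, measurable V ->
        measurable_fun setT (fun w => reports_law G (g t w) V) /\
        forall E, past t E ->
          (P (E `&` Y t @^-1` V) =
           \int[P]_(w in E) reports_law G (g t w) V)%E &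
      forall t, is_cond_expectation (past t)
        (fun w => (Z_ t w)%:R) (fun w => accept_prob G gstar (eta_ t w))].

Definition regret (L : set R) (T : nat) : \bar R :=
  ('E_P [fun w => (\sum_(t < T) gap G gstar L (eta_ t w))%R])%E.

End interaction.

(* Main.v *)
Require Import Defs.
From HB Require Import structures.
From mathcomp Require Import all_boot all_order all_algebra.
From mathcomp Require Import all_classical all_reals all_analysis.
From mathcomp Require Import measurable_realfun.
From mathcomp Require Import lra ring zify.
Set Implicit Arguments.
Unset Strict Implicit.
Unset Printing Implicit Defensive.
Import Order.TTheory GRing.Theory Num.Theory.
Import numFieldNormedType.Exports.
Local Open Scope classical_set_scope.
Local Open Scope ring_scope.

(** Call a phase clean if, at each of its rounds, the empirical acceptance rate
    of every threshold is within its confidence radius of the true one.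

    On a clean phase, activation keeps the whole threshold space covered, since
    a fresh point has radius at least 1; hence the chosen threshold [v] has
    index at least [U*] and its gap is at most 3 radii. So [v] is played at
    most [72 lbar^2 i / gap(v)^2] times, and no active radius ever drops below
    a quarter of the gap of its center: two active thresholds with gaps in
    [(r/2, r]] are more than [r/8] apart and fall in distinct sets of the
    zooming cover. Summing over the dyadic levels above [2^-K] bounds the
    regret of phase [i] by
    [2^i 2^-K + 288 lbar^2 i Cz 2^(K (dz + 1))], and [K] is chosen at the end.

    Played thresholds are random, so they are designated by the round [s] of
    their first play. The error accumulated by the plays from round [s] on is
    controlled by an exponential supermartingale, and a union bound over [s],
    the current round and the number of plays shows that phase [i] is unclean
    with probability at most [2 / 2^i]. An unclean phase costs at most [2^i]
    times the largest gap, which is at most [Cz^(1 / (dz + 2))]. *)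

(** * The one-shot game *)

Lemma measurable_accepts (R : realType) (G : game R) eta :
  measurable [set y : R * R | accepts G eta y].
Proof.
rewrite (_ : [set y | _] =
  (fun y : R * R => `|y.1 - y.2|) @^-1` `]-oo, eta * Delta G]%classic); last first.
  by apply/seteqP; split=> y /=; rewrite /accepts in_itv.
rewrite -[X in measurable X]setTI.
have : measurable_fun [set: R * R] (fun y : R * R => `|y.1 - y.2|).
  by apply: measurableT_comp => //; exact: measurable_funB.
by apply => //; exact: measurable_itv.
Qed.

Lemma measurable_observed (R : realType) :
  measurable_fun setT (@observed R).
Proof.
have mh : measurable_fun setT (@y_honest R).
  by apply: measurable_funD; do 2 apply: measurableT_comp => //;
    apply: measurableT_comp.
have ma : measurable_fun setT (@y_adv R).
  by apply: measurable_funD; do 2 apply: measurableT_comp => //.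
by apply: measurable_fun_ifT => //; exact: measurable_fun_pair.
Qed.

Lemma probability_fine_ge0_le1 d (T : measurableType d) (R : realType)
    (P : probability T R) (A : set T) : measurable A -> 0 <= fine (P A) <= 1.
Proof.
move=> mA; rewrite fine_ge0//= -lee_fin fineK; first exact: probability_le1.
exact: fin_num_measure.
Qed.

Lemma PA_ge0_le1 (R : realType) (G : game R) g eta : 0 <= PA G g eta <= 1.
Proof.
have mA : measurable (@observed R @^-1` [set y | accepts G eta y]).
  rewrite -[X in measurable X]setTI.
  by apply: measurable_observed => //; exact: measurable_accepts.
exact: (probability_fine_ge0_le1 (game_law G g) mA).
Qed.

(** A density accepted at least as often as the best response cannot have a larger MMSE, since it
    would then give the adversary strictly more. So the supremum defining [cfun] is attained at
    [gstar eta]. *)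
Lemma induced_utilityE (R : realType) (G : game R) gstar eta :
  worst_best_response G eta (gstar eta) ->
  induced_utility G gstar eta = Ffun G eta (accept_prob G gstar eta).
Proof.
move=> [best _]; rewrite /induced_utility /Ffun /cfun; congr (QDC G _ _).
set B := [set MMSE G g eta | g in _].
have Bm : B (induced_mmse G gstar eta) by exists (gstar eta) => //=; exact: lexx.
have ub : ubound B (induced_mmse G gstar eta).
  move=> _ [g /= ag <-]; rewrite leNgt; apply/negP => lt_m.
  have := best g; rewrite leNgt => /negP; apply; rewrite /UAD.
  apply: (lt_le_trans (QAD_mono1 G (PA G (gstar eta) eta) lt_m)).
  move: ag; rewrite /accept_prob le_eqVlt => /predU1P[->//|/(QAD_mono2 G (MMSE G g eta))].
  exact: ltW.
apply/eqP; rewrite eq_le; apply/andP; split.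
  by apply: ub_le_sup => //; exists (induced_mmse G gstar eta).
by apply: ge_sup => //; exists (induced_mmse G gstar eta).
Qed.

(** * Concentration of the acceptance rates *)

(** Since [expR (- x)] is at least [(1 - x/4)^4], it is enough that [(1 + x + x^2) (1 - x/4)^4] be
    at least 1, a polynomial inequality. *)
Lemma expR_le1DxD2 (R : realType) (x : R) : `|x| <= 3%:R / 5%:R ->
  expR x <= 1 + x + x ^+ 2.
Proof.
rewrite ler_norml => /andP[x1 x2].
have p0 : 0 < 1 + - (x / 4%:R) by lra.
have h : (1 + - (x / 4%:R)) ^+ 4 <= expR (- x).
  have -> : - x = - (x / 4%:R) * 4%:R by field.
  rewrite expRM_natr.
  by rewrite lerXn2r ?nnegrE ?expR_ge0 ?(ltW p0)// expR_ge1Dx.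
have -> : x = - - x by rewrite opprK.
rewrite expRN -[X in X <= _]mul1r ler_pdivrMr ?expR_gt0// opprK.
have q0 : 0 <= 1 + x + x ^+ 2 by nra.
apply: le_trans (ler_wpM2l q0 h).
have -> : (1 + x + x ^+ 2) * (1 - x / 4%:R) ^+ 4 =
  1 + x ^+ 2 * (96%:R / 256%:R - 176%:R / 256%:R * x + 81%:R / 256%:R * x ^+ 2
   - 15%:R / 256%:R * x ^+ 3 + x ^+ 4 / 256%:R) by field.
rewrite lerDl; apply: mulr_ge0; first exact: sqr_ge0.
have x20 : 0 <= x ^+ 2 by exact: sqr_ge0.
have x40 : 0 <= x ^+ 4 by exact: (exprn_even_ge0 (n := 4)).
have x31 : x ^+ 3 <= x ^+ 2.
  by rewrite exprS -[leRHS]mul1r ler_wpM2r//; lra.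
(* The quartic factor is bounded below by a quadratic: [x^3 <= x^2] turns [81 x^2 - 15 x^3] into at
   least [66 x^2], and [x^4] is dropped. *)
have : 176%:R * x - 66%:R * x ^+ 2 <= 96%:R; last by lra.
nra.
Qed.

(** This is the moment generating function of a centered Bernoulli variable. After the quadratic
    bound on the exponential the linear terms cancel, leaving the variance [a (1 - a)], at most
    1/4. *)
Lemma bernoulli_mgf_le (R : realType) (a lam : R) :
  0 <= a <= 1 -> `|lam| <= 3%:R / 5%:R ->
  a * expR (lam * (1 - a)) + (1 - a) * expR (- (lam * a)) <=
    expR (lam ^+ 2 / 4%:R).
Proof.
move=> /andP[a0 a1] hl.
have h1 : expR (lam * (1 - a)) <= 1 + lam * (1 - a) + (lam * (1 - a)) ^+ 2.
  apply: expR_le1DxD2; rewrite normrM.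
  apply: le_trans hl; rewrite -[leRHS]mulr1 ler_wpM2l ?normr_ge0//.
  by rewrite ger0_norm; lra.
have h2 : expR (- (lam * a)) <= 1 - lam * a + (- (lam * a)) ^+ 2.
  apply: expR_le1DxD2; rewrite normrN normrM.
  apply: le_trans hl; rewrite -[leRHS]mulr1 ler_wpM2l ?normr_ge0//.
  by rewrite ger0_norm; lra.
have a1' : 0 <= 1 - a by lra.
apply: (le_trans (lerD (ler_wpM2l a0 h1) (ler_wpM2l a1' h2))).
apply: le_trans (expR_ge1Dx _).
have -> : a * (1 + lam * (1 - a) + (lam * (1 - a)) ^+ 2) +
  (1 - a) * (1 - lam * a + (- (lam * a)) ^+ 2) =
  1 + lam ^+ 2 * (a * (1 - a)) by ring.
rewrite lerD2l ler_wpM2l ?sqr_ge0//.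
have : 0 <= (a - 2^-1) ^+ 2 by exact: sqr_ge0.
nra.
Qed.

(** * Integration against functions of the past *)

Import HBNNSimple.

Lemma measurable_fun_sub_sigma d d' (T : measurableType d) (T' : measurableType d')
    (G : set (set T)) (f : T -> T') : G `<=` measurable ->
  measurable_fun (setT : set (g_sigma_algebraType G)) f -> measurable_fun setT f.
Proof.
move=> Gm mf _ B mB; have := mf measurableT B mB; rewrite !setTI.
by apply: smallest_sub => //; exact: sigma_algebra_measurable.
Qed.

(** The level sets of [h] are events of the generated sigma-algebra, so integrals that agree on such
    events can be compared term by term. *)
Lemma nnsfun_integral_sub_sigma d (T : measurableType d) (R : realType)
    (P : {measure set T -> \bar R}) (G : set (set T)) (X : T -> R)
    (h : {nnsfun (g_sigma_algebraType G) >-> R}) :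
  G `<=` measurable -> measurable_fun setT X -> (forall w, 0 <= X w) ->
  (\int[P]_w (h w * X w)%:E =
   \sum_(y \in range h) y%:E * \int[P]_(w in h @^-1` [set y]) (X w)%:E)%E.
Proof.
move=> Gm mX X0.
have mh y : measurable (h @^-1` [set y] : set T).
  have : measurable (h @^-1` [set y] : set (g_sigma_algebraType G)).
    exact: measurable_sfunP.
  by apply: smallest_sub => //; exact: sigma_algebra_measurable.
transitivity (\int[P]_w (\sum_(y \in range h)
    (y * \1_(h @^-1` [set y]) w * X w)%:E))%E.
  apply: eq_integral => w _; rewrite [in LHS]fimfunE fsumEFin//.
  by congr EFin; rewrite !fsbig_finite//= mulr_suml.
rewrite ge0_integral_fsum//; last 2 first.
- move=> y; apply/measurable_EFinP; apply: measurable_funM => //.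
  by apply: measurable_funM => //; exact: measurable_indic.
- move=> y w _; rewrite lee_fin.
  have [yh|yh] := pselect (h w = y).
    by rewrite !mulr_ge0// -yh.
  by rewrite indicE memNset ?mulr0 ?mul0r//; exact/eqP.
apply: eq_fsbigr => y; rewrite inE => -[w0 _ <-].
rewrite [in RHS]integral_mkcond -ge0_integralZl//=; last 3 first.
- by apply/(measurable_restrictT _ (mh _)).1; apply: measurable_funTS; exact/measurable_EFinP.
- by move=> w _; apply: erestrict_ge0 => z _; rewrite lee_fin.
- by rewrite lee_fin.
apply: eq_integral => w _.
rewrite /patch indicE; case: ifPn => _; last by rewrite mulr0 mul0r mule0.
by rewrite mulr1 EFinM.
Qed.


(** Taking out what is known from a conditional expectation: simple [f] reduce to the events of the
    sigma-algebra, and monotone convergence gives the general non-negative [f]. *)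
Lemma integral_mul_sub_sigma d (T : measurableType d) (R : realType)
    (P : {measure set T -> \bar R}) (G : set (set T)) (X X' f : T -> R) :
  G `<=` measurable -> measurable_fun setT X -> measurable_fun setT X' ->
  (forall w, 0 <= X w) -> (forall w, 0 <= X' w) ->
  (forall E, <<s G >> E ->
    \int[P]_(w in E) (X w)%:E = \int[P]_(w in E) (X' w)%:E)%E ->
  measurable_fun (setT : set (g_sigma_algebraType G)) f ->
  (forall w, 0 <= f w) ->
  (\int[P]_w (f w * X w)%:E = \int[P]_w (f w * X' w)%:E)%E.
Proof.
move=> Gm mX mX' X0 X'0 XX' mf f0.
have mEf : measurable_fun (setT : set (g_sigma_algebraType G)) (EFin \o f).
  exact/measurable_EFinP.
pose phi := nnsfun_approx measurableT mEf.
have mphi n : measurable_fun (setT : set T) (phi n : T -> R).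
  exact: (measurable_fun_sub_sigma Gm).
have lim_phi (V : T -> R) : measurable_fun setT V -> (forall w, 0 <= V w) ->
    (\int[P]_w (f w * V w)%:E =
     limn (fun n => \int[P]_w (phi n w * V w)%:E))%E.
  move=> mV V0; rewrite -monotone_convergence//.
  - apply: eq_integral => w _; apply/esym/cvg_lim => //.
    under eq_fun do rewrite EFinM muleC.
    rewrite EFinM muleC; apply: cvgeZl => //.
    by apply: (cvg_nnsfun_approx _ mEf) => //= y _; rewrite lee_fin.
  - by move=> n; apply/measurable_EFinP; exact: measurable_funM.
  - by move=> n w _; rewrite lee_fin mulr_ge0.
  - move=> w _ m n mn; rewrite lee_fin ler_wpM2r//.
    by have /lefP := nd_nnsfun_approx measurableT mEf mn.
rewrite !lim_phi//; congr (limn _); apply/funext => n.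
rewrite !nnsfun_integral_sub_sigma//.
apply: eq_fsbigr => y _; rewrite XX'//.
have : measurable (phi n @^-1` [set y] : set (g_sigma_algebraType G)).
  exact: measurable_sfunP.
by [].
Qed.

Lemma measurable_big_nat d (T : measurableType d) (R : realType)
    (f : nat -> T -> R) (s t : nat) :
  (forall r, (s <= r < t)%N -> measurable_fun setT (f r)) ->
  measurable_fun setT (fun w => \sum_(s <= r < t) f r w).
Proof.
move=> mf.
(* Terms outside the range are replaced by 0, because [measurable_sum] asks every term to be
   measurable. *)
have -> : (fun w => \sum_(s <= r < t) f r w) = fun w =>
    \sum_(s <= r < t) (if (s <= r < t)%N then f r w else 0).
  by apply/funext => w; apply: eq_big_nat => r rst; rewrite rst.
apply: measurable_sum => r.
by case: (boolP (s <= r < t)%N) => [/mf//|_]; exact: measurable_cst.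
Qed.

(** * Exponential supermartingale and deviation bounds *)

Section bernoulli_concentration.
Context d (T : measurableType d) (R : realType) (P : probability T R).
Variables (past : nat -> set (set T)).
Variables (e al : nat -> T -> R) (z : nat -> T -> bool).
Local Notation past_type t := (g_sigma_algebraType (past t)).
Hypothesis past_measurable : forall t, past t `<=` measurable.
Hypothesis measurable_e : forall r t, (r <= t)%N ->
  measurable_fun (setT : set (past_type t)) (e r).
Hypothesis measurable_al : forall r t, (r <= t)%N ->
  measurable_fun (setT : set (past_type t)) (al r).
Hypothesis measurable_z : forall r t, (r < t)%N ->
  measurable_fun (setT : set (past_type t)) (z r).
Hypothesis al01 : forall t w, 0 <= al t w <= 1.
Hypothesis cond_z : forall t E, <<s past t >> E ->
  (\int[P]_(w in E) (al t w)%:E = \int[P]_(w in E) (z t w)%:R%:E)%E.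

Let measurable_past t (f : T -> R) :
  measurable_fun (setT : set (past_type t)) f ->
  measurable_fun (setT : set T) f.
Proof. exact: measurable_fun_sub_sigma. Qed.

Let measurable_zR t : measurable_fun (setT : set T) (fun w => (z t w)%:R : R).
Proof.
apply: (@measurable_past t.+1).
apply: (@measurableT_comp _ _ _ _ _ _ (fun b : bool => b%:R : R)) => //.
exact: measurable_z.
Qed.

Let measurable_alT t : measurable_fun (setT : set T) (al t).
Proof. by apply: (@measurable_past t); exact: measurable_al. Qed.

(** Complement of [cond_z]. The supermartingale step is split over rejection and acceptance so that
    all factors stay non-negative, and this handles the rejections. *)
Lemma cond_notz t E : <<s past t >> E ->
  (\int[P]_(w in E) (1 - al t w)%:E = \int[P]_(w in E) (1 - (z t w)%:R)%:E)%E.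
Proof.
move=> pE.
have mE : measurable E.
  have : <<s past t >> `<=` measurable; last exact.
  by apply: smallest_sub => //; exact: sigma_algebra_measurable.
have z1 w : 0 <= 1 - (z t w)%:R :> R by case: (z t w); rewrite ?subrr// subr0.
have a1 w : 0 <= 1 - al t w by rewrite subr_ge0; case/andP: (al01 t w).
have a0 w : 0 <= al t w by case/andP: (al01 t w).
have split_al : (\int[P]_(w in E) (1 - al t w)%:E +
    \int[P]_(w in E) (al t w)%:E = P E)%E.
  rewrite -ge0_integralD; first last.
  - by apply/measurable_EFinP/measurable_funTS.
  - by move=> w _; rewrite lee_fin.
  - by apply/measurable_EFinP/measurable_funTS/measurable_funB.
  - by move=> w _; rewrite lee_fin.
  - by [].
  rewrite (eq_integral (cst 1%E)) ?integral_cst// ?mul1e//.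
  by move=> w _; rewrite -EFinD subrK.
have split_z : (\int[P]_(w in E) (1 - (z t w)%:R)%:E +
    \int[P]_(w in E) (z t w)%:R%:E = P E)%E.
  rewrite -ge0_integralD; first last.
  - by apply/measurable_EFinP/measurable_funTS.
  - by move=> w _; rewrite lee_fin.
  - by apply/measurable_EFinP/measurable_funTS/measurable_funB.
  - by move=> w _; rewrite lee_fin.
  - by [].
  rewrite (eq_integral (cst 1%E)) ?integral_cst// ?mul1e//.
  by move=> w _; rewrite -EFinD subrK.
have fin_al : (\int[P]_(w in E) (al t w)%:E)%E \is a fin_num.
  rewrite ge0_fin_numE; last by apply: integral_ge0 => w _; rewrite lee_fin.
  apply: (@le_lt_trans _ _ (P E)); last by apply: le_lt_trans (probability_le1 P mE) _; rewrite ltry.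
  by rewrite -split_al leeDr//; apply: integral_ge0 => w _; rewrite lee_fin.
by rewrite -[LHS](addeK _ fin_al) split_al -split_z -cond_z// addeK.
Qed.

(* The process [t |-> weight s lam t] is a supermartingale started at 1 in
   round [s]; it only moves when the threshold of round [s] is played again. *)
Definition weight (s : nat) (lam : R) (t : nat) (w : T) : R :=
  expR (\sum_(s <= r < t) (if e r w == e s w
     then lam * ((z r w)%:R - al r w) - lam ^+ 2 / 4%:R else 0)).

Lemma measurable_weight s lam t : (s <= t)%N ->
  measurable_fun (setT : set (past_type t)) (weight s lam t).
Proof.
move=> st; apply: measurableT_comp => //.
apply: measurable_big_nat => r /andP[sr rt].
apply: measurable_fun_ifT => //.
  by apply: measurable_fun_eqr; apply: measurable_e => //; exact: ltnW.
apply: measurable_funB => //; apply: measurable_funM => //.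
apply: measurable_funB; last by apply: measurable_al; exact: ltnW.
apply: (@measurableT_comp _ _ _ _ _ _ (fun b : bool => b%:R : R)) => //.
exact: measurable_z.
Qed.

(** The new outcome enters linearly, through [1 - z] and [z], with non-negative coefficients that
    depend on the past only. *)
Lemma weightS s lam t w : (s <= t)%N -> weight s lam t.+1 w =
  weight s lam t w * (if e t w == e s w
    then expR (- (lam ^+ 2 / 4%:R)) * expR (- (lam * al t w)) else 1)
    * (1 - (z t w)%:R) +
  weight s lam t w * (if e t w == e s w
    then expR (- (lam ^+ 2 / 4%:R)) * expR (lam * (1 - al t w)) else 1)
    * (z t w)%:R.
Proof.
move=> st; rewrite /weight big_nat_recr//= expRD -!mulrA -mulrDr; congr (_ * _).
case: ifP => _; last by rewrite expR0 !mul1r subrK.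
rewrite -!expRD; case: (z t w).
  by rewrite subrr mulr0 add0r mulr1 addrC.
by rewrite subr0 mulr0 addr0 mulr1 sub0r mulrN addrC.
Qed.

Lemma integral_weight_le1 s lam t : `|lam| <= 3%:R / 5%:R -> (s <= t)%N ->
  (\int[P]_w (weight s lam t w)%:E <= 1)%E.
Proof.
move=> lam_small st; rewrite -(subnKC st); elim: (t - s)%N => [|k IH].
  rewrite addn0 (eq_integral (cst 1%E)); first by rewrite integral_cst// mul1e; exact: probability_le1.
  by move=> w _; rewrite /weight big_geq// expR0.
rewrite addnS; set u := (s + k)%N in IH *; have su : (s <= u)%N by exact: leq_addr.
apply: le_trans IH.
set c := expR (- (lam ^+ 2 / 4%:R)).
pose f0 w := weight s lam u w *
  (if e u w == e s w then c * expR (- (lam * al u w)) else 1).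
pose f1 w := weight s lam u w *
  (if e u w == e s w then c * expR (lam * (1 - al u w)) else 1).
have w0 w : 0 <= weight s lam u w by exact: expR_ge0.
have f00 w : 0 <= f0 w.
  by rewrite mulr_ge0//; case: ifP => // _; rewrite mulr_ge0 ?expR_ge0.
have f10 w : 0 <= f1 w.
  by rewrite mulr_ge0//; case: ifP => // _; rewrite mulr_ge0 ?expR_ge0.
have meq : measurable_fun (setT : set (past_type u)) (fun w => e u w == e s w).
  by apply: measurable_fun_eqr; exact: measurable_e.
have mf0 : measurable_fun (setT : set (past_type u)) f0.
  apply: measurable_funM; first exact: measurable_weight.
  apply: measurable_fun_ifT => //; apply: measurable_funM => //.
  apply: measurableT_comp => //; apply: measurableT_comp => //.
  by apply: measurable_funM => //; exact: measurable_al.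
have mf1 : measurable_fun (setT : set (past_type u)) f1.
  apply: measurable_funM; first exact: measurable_weight.
  apply: measurable_fun_ifT => //; apply: measurable_funM => //.
  apply: measurableT_comp => //; apply: measurable_funM => //.
  by apply: measurable_funB => //; exact: measurable_al.
have z1 w : 0 <= 1 - (z u w)%:R :> R by case: (z u w); rewrite ?subrr// subr0.
have a1 w : 0 <= 1 - al u w by rewrite subr_ge0; case/andP: (al01 u w).
have a0 w : 0 <= al u w by case/andP: (al01 u w).
have mf0T := measurable_past mf0; have mf1T := measurable_past mf1.
have m1z : measurable_fun (setT : set T) (fun w => 1 - (z u w)%:R : R).
  exact: measurable_funB.
have m1a : measurable_fun (setT : set T) (fun w => 1 - al u w).
  exact: measurable_funB.
rewrite (eq_integral (fun w => (f0 w * (1 - (z u w)%:R))%:E +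
    (f1 w * (z u w)%:R)%:E)%E); last by move=> w _; rewrite weightS.
rewrite ge0_integralD; [|by []| | | |]; last 4 first.
- by move=> w _; rewrite lee_fin mulr_ge0.
- by apply/measurable_EFinP/measurable_funM.
- by move=> w _; rewrite lee_fin mulr_ge0.
- by apply/measurable_EFinP/measurable_funM.
(* The outcomes [1 - z] and [z] are replaced by their conditional expectations [1 - al] and [al]. *)
rewrite -(@integral_mul_sub_sigma _ _ _ P (past u) (fun w => 1 - al u w) _ f0)//; last first.
  exact: cond_notz.
rewrite -(@integral_mul_sub_sigma _ _ _ P (past u) (al u) _ f1)//; last first.
  exact: cond_z.
rewrite -ge0_integralD; [|by []| | | |]; last 4 first.
- by move=> w _; rewrite lee_fin mulr_ge0.
- by apply/measurable_EFinP/measurable_funM.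
- by move=> w _; rewrite lee_fin mulr_ge0.
- by apply/measurable_EFinP/measurable_funM.
apply: ge0_le_integral; first by [].
- by move=> w _; rewrite -EFinD lee_fin addr_ge0// mulr_ge0.
- by apply/emeasurable_funD; apply/measurable_EFinP/measurable_funM.
- by apply/measurable_EFinP; apply: (@measurable_past u); exact: measurable_weight.
move=> w _; rewrite -EFinD lee_fin /f0 /f1.
(* If another threshold is played the weight does not move; otherwise the compensator [lam^2 / 4]
   absorbs the moment generating function. *)
case: ifP => _; last by rewrite !mulr1 -mulrDr subrK mulr1.
rewrite -!mulrA -!mulrDr -[leRHS]mulr1 ler_wpM2l//.
rewrite /c expRN ler_pdivrMl ?expR_gt0// mulr1 addrC mulrC [X in _ + X]mulrC.
exact: bernoulli_mgf_le.
Qed.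

Definition nplays (s t : nat) (w : T) : nat :=
  \sum_(s <= r < t) (e r w == e s w).

Definition noise (s t : nat) (w : T) : R :=
  \sum_(s <= r < t) (if e r w == e s w then (z r w)%:R - al r w else 0).

(** Fixing the number [n] of plays makes the confidence radius deterministic; the sign [b] selects
    the tail. *)
Definition deviation (eps : R) (s t n : nat) (b : bool) : set T :=
  [set w | nplays s t w = n /\ n%:R * eps < (-1) ^+ b * noise s t w].

Lemma noise_le_nplays s t w (b : bool) : (-1) ^+ b * noise s t w <= (nplays s t w)%:R.
Proof.
rewrite /noise /nplays natr_sum mulr_sumr; apply: ler_sum => r _.
have /andP[a0 a1] := al01 r w.
case: (e r w == e s w) => /=; last by rewrite mulr0.
by case: b; case: (z r w) => /=; rewrite ?expr0 ?expr1 ?mul1r ?mulN1r; lra.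
Qed.

Lemma measurable_deviation eps s t n b : measurable (deviation eps s t n b).
Proof.
have meq r : measurable_fun (setT : set T) (fun w => e r w == e s w).
  apply: (@measurable_fun_eqr _ _ _ setT (e r) (e s)).
    by apply: (@measurable_past r); exact: measurable_e.
  by apply: (@measurable_past s); exact: measurable_e.
have mN : measurable_fun (setT : set T) (fun w => (nplays s t w)%:R : R).
  under eq_fun do rewrite /nplays natr_sum.
  apply: measurable_big_nat => r _.
  exact: (@measurableT_comp _ _ _ _ _ _ (fun b : bool => b%:R : R)).
have mM : measurable_fun (setT : set T) (fun w => (-1) ^+ b * noise s t w).
  apply: measurable_funM => //; apply: measurable_big_nat => r _.
  by apply: measurable_fun_ifT => //; exact: measurable_funB.
rewrite (_ : deviation _ _ _ _ _ =
    ((fun w => (nplays s t w)%:R : R) @^-1` [set n%:R]) `&`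
    ((fun w => (-1) ^+ b * noise s t w) @^-1` `]n%:R * eps, +oo[%classic)).
  apply: measurableI.
    by rewrite -[X in measurable X]setTI; exact: mN.
  by rewrite -[X in measurable X]setTI; exact: mM.
apply/seteqP; split=> w /=; rewrite in_itv/= andbT => -[wN wM]; split => //.
  by rewrite wN.
by apply/eqP; rewrite -(eqr_nat R) wN.
Qed.

Lemma deviation_set0 eps s t n b : 1 < eps -> (0 < n)%N ->
  deviation eps s t n b = set0.
Proof.
move=> eps1 n0; apply/seteqP; split=> // w [wN]; rewrite ltNge => /negP; apply.
apply: le_trans (noise_le_nplays s t w b) _.
by rewrite wN -[leLHS]mulr1 ler_wpM2l// ltW.
Qed.

Lemma deviation_le eps s t n b : 0 <= eps <= 1 -> (s <= t)%N ->
  (P (deviation eps s t n b) <=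
   (expR (- (51%:R / 100%:R * (n%:R * eps ^+ 2))))%:E)%E.
Proof.
move=> /andP[eps0 eps1] st.
(* As [eps <= 1], this choice stays in the range of [bernoulli_mgf_le]. The exponent it yields is
   [(3/5 - 9/100) n eps^2], whence the constant 51/100. *)
pose lam := (-1) ^+ b * (3%:R / 5%:R * eps).
have lam2 : lam ^+ 2 = 9%:R / 25%:R * eps ^+ 2.
  by rewrite /lam exprMn -exprM mulnC exprM sqrrN expr1n expr1n mul1r; field.
have lam_small : `|lam| <= 3%:R / 5%:R.
  rewrite /lam normrM normrX normrN1 expr1n mul1r ger0_norm; last by lra.
  by lra.
have := integral_weight_le1 lam_small st.
set c := 51%:R / 100%:R * (n%:R * eps ^+ 2) => int_le1.
have mD := measurable_deviation eps s t n b.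
(* Markov's inequality: the weight is at least [expR c] on the deviation event. *)
have : ((expR c)%:E * P (deviation eps s t n b) <= 1)%E.
  apply: le_trans int_le1.
  rewrite -[deviation _ _ _ _ _]setIT -integral_indic// -ge0_integralZl; first last.
  - by rewrite lee_fin expR_ge0.
  - by move=> w _; rewrite lee_fin.
  - by apply/measurable_EFinP; exact: measurable_indic.
  - by [].
  apply: ge0_le_integral; first by [].
  - by move=> w _; rewrite -EFinM lee_fin mulr_ge0 ?expR_ge0.
  - by apply/measurable_EFinP; apply: measurable_funM => //; exact: measurable_indic.
  - by apply/measurable_EFinP; apply: (@measurable_past t); exact: measurable_weight.
    move=> w _; rewrite -EFinM lee_fin indicE.
    have [|_] := boolP (w \in _); last by rewrite mulr0 expR_ge0.
    rewrite inE mulr1 => -[wN wM]; rewrite /weight ler_expR.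
    have -> : \sum_(s <= r < t) (if e r w == e s w then
        lam * ((z r w)%:R - al r w) - lam ^+ 2 / 4%:R else 0) =
        lam * noise s t w - lam ^+ 2 / 4%:R * n%:R.
      rewrite -wN /noise /nplays natr_sum !mulr_sumr -sumrB.
      apply: eq_bigr => r _; case: (e r w == e s w) => /=.
        by rewrite mulr1.
      by rewrite !mulr0 subrr.
    rewrite lam2 /c /lam.
    have := ler_wpM2l (mulr_ge0 (ler0n R 3) eps0) (ltW wM).
    by rewrite expr2; lra.
move=> cP; have finP : P (deviation eps s t n b) \is a fin_num by apply: fin_num_measure.
move: cP; rewrite -(fineK finP) -EFinM !lee_fin expRN => cP.
by rewrite -[leRHS]mul1r ler_pdivlMr ?expR_gt0// mulrC.
Qed.

Lemma deviation_sqrt_le (i s t n : nat) (b : bool) : (0 < n)%N -> (0 < i)%N ->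
  (P (deviation (Num.sqrt ((8 * i)%:R / (2 + n)%:R)) s t n b) <=
   (expR (- (3%:R * i%:R)))%:E)%E.
Proof.
move=> n0 i0; set eps := Num.sqrt _.
have [ts|st] := ltnP t s.
  rewrite (_ : deviation _ _ _ _ _ = set0) ?measure0 ?lee_fin ?expR_ge0//.
  apply/seteqP; split=> // w [wN _]; move: n0.
  by rewrite -wN /nplays big_geq// ltnW.
have [eps1|eps1] := ltP 1 eps.
  by rewrite deviation_set0// measure0 lee_fin expR_ge0.
apply: le_trans (deviation_le _ _ _ st) _; first by rewrite sqrtr_ge0.
rewrite lee_fin ler_expR lerN2.
have n2_gt0 : 0 < (2 + n)%:R :> R by rewrite ltr0n.
have eps2 : eps ^+ 2 = (8 * i)%:R / (2 + n)%:R by rewrite sqr_sqrtr// divr_ge0.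
have : eps ^+ 2 <= 1 by rewrite expr_le1// sqrtr_ge0.
rewrite eps2 ler_pdivrMr// mul1r ler_nat => i8n.
rewrite mulrA mulrA ler_pdivlMr// -!natrM.
(* It amounts to [600 <= 108 n], and [eps <= 1] forces [n >= 8 i - 2 >= 6]. Radii above 1 were
   excluded because the deviation event is then empty. *)
have : (300 * i * (2 + n) <= 408 * i * n)%N by nia.
by rewrite -(ler_nat R) !natrM; lra.
Qed.
End bernoulli_concentration.

(** * The zooming algorithm along a path *)

Lemma phase_bounds t : (2 ^ phase t <= t.+2 < 2 ^ (phase t).+1)%N.
Proof. by apply: trunc_log_bounds. Qed.

Lemma phase_eq i t : (2 ^ i <= t.+2 < 2 ^ i.+1)%N -> phase t = i.
Proof. exact: trunc_log_eq. Qed.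

Lemma phase_gt0 t : (0 < phase t)%N.
Proof. by rewrite /phase trunc_log_gt0. Qed.

Lemma phase_start_le t : (phase_start t <= t)%N.
Proof.
rewrite /phase_start leq_subLR addnC addn2.
by case/andP: (phase_bounds t).
Qed.

Lemma phaseS t : t.+1 = phase_start t.+1 \/ phase t.+1 = phase t.
Proof.
have /andP[lo hi] := phase_bounds t.
have [ht|ht] := ltnP t.+3 (2 ^ (phase t).+1).
  by right; apply: phase_eq; rewrite ht andbT (leq_trans lo).
left; have e : t.+3 = (2 ^ (phase t).+1)%N by apply/eqP; rewrite eqn_leq ht hi.
rewrite /phase_start (@phase_eq (phase t).+1) -?e ?subn2//.
by rewrite leqnn /= expnS -e; lia.
Qed.

Section zooming_path.
Variables (R : realType) (L : set R) (D F : R -> R -> R) (lbar : R).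
Variables (pi : policy R) (S : history R -> set R).
Variables (h : nat -> history R) (y : nat -> R * R) (z : nat -> bool).
Hypothesis h0 : h 0%N = [::].
Hypothesis hS : forall t, h t.+1 = rcons (h t) (Round (pi (h t)) (y t) (z t)).
Local Notation arm t := (pi (h t)).
Hypothesis zoom : forall h, [/\ activation L D lbar S h, S h (pi h) &
  forall v, S h v -> zoom_index F lbar h v <= zoom_index F lbar h (pi h)].
Hypothesis metricD : is_metric_on L D.
Hypothesis D_le1 : forall x y, L x -> L y -> D x y <= 1.
Hypothesis lbar_ge1 : 1 <= lbar.

(** * Plays and active sets along the path *)

Lemma size_path t : size (h t) = t.
Proof. by elim: t => [|t IH]; rewrite ?h0// hS size_rcons IH. Qed.

Lemma count_path (p : pred (round R)) a t : (a <= t)%N ->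
  count p (drop a (h t)) =
  (\sum_(a <= r < t) p (Round (arm r) (y r) (z r)))%N.
Proof.
move=> a_t; rewrite -(subnKC a_t); elim: (t - a)%N => [|k IH].
  by rewrite addn0 big_geq// drop_oversize// size_path.
rewrite addnS hS big_nat_recr ?leq_addr//= -IH drop_rcons.
  by rewrite -cats1 count_cat /= addn0.
by rewrite size_path leq_addr.
Qed.

Lemma plays_path t v :
  plays (h t) v = (\sum_(phase_start t <= r < t) (arm r == v))%N.
Proof.
by rewrite /plays /phase_rounds size_path count_path// phase_start_le.
Qed.

Lemma accepted_plays_path t v : accepted_plays (h t) v =
  (\sum_(phase_start t <= r < t) ((arm r == v) && z r))%N.
Proof.
by rewrite /accepted_plays /phase_rounds size_path count_path// phase_start_le.
Qed.

Lemma accepted_plays_le t v : (accepted_plays (h t) v <= plays (h t) v)%N.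
Proof.
rewrite /accepted_plays /plays; apply: sub_count => o /=.
by case/andP.
Qed.

Lemma prior_active_start t : t = phase_start t -> prior_active S (h t) = set0.
Proof. by move=> e; rewrite /prior_active size_path -e eqxx. Qed.

Lemma prior_activeS t : phase t.+1 = phase t ->
  prior_active S (h t.+1) = S (h t).
Proof.
move=> e; rewrite /prior_active size_path hS -cats1 take_size_cat ?size_path//.
rewrite ifF//; apply/negbTE; rewrite neq_ltn.
apply/orP; right; rewrite ltnS /phase_start e; exact: phase_start_le.
Qed.

Lemma activationP t :
  (S (h t) = prior_active S (h t) /\
   L `<=` covered L D lbar (h t) (prior_active S (h t))) \/
  exists v, [/\ L v, ~ covered L D lbar (h t) (prior_active S (h t)) v &
    S (h t) = v |` prior_active S (h t)].
Proof.
have [act _ _] := zoom (h t); move: act; rewrite /activation.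
by case: asboolP => [c|_]; [left|right].
Qed.

Lemma prior_active_sub t : prior_active S (h t) `<=` S (h t).
Proof.
by case: (activationP t) => [[-> _]//|[v [_ _ ->]]] x Sx; right.
Qed.

Lemma active_sub t : S (h t) `<=` L.
Proof.
have step u : prior_active S (h u) `<=` L -> S (h u) `<=` L.
  by case: (activationP u) => [[-> _]//|[v [Lv _ ->]]] pL x [->//|/pL].
elim: t => [|t IH]; apply: step; first by rewrite prior_active_start.
by case: (phaseS t) => [/prior_active_start ->//|/prior_activeS ->].
Qed.

Lemma threshold_in t : L (arm t).
Proof. by have [_ Se _] := zoom (h t); exact: active_sub Se. Qed.

Lemma played_prior_active t v : (0 < plays (h t) v)%N ->
  prior_active S (h t) v.
Proof.
rewrite plays_path; elim: t => [|t IH].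
  by rewrite big_geq.
case: (phaseS t) => [<-|same]; first by rewrite big_geq.
rewrite prior_activeS// {1}/phase_start same big_nat_recr ?phase_start_le//=.
case: eqP => [<- _|_]; first by have [_ Se _] := zoom (h t).
by rewrite addn0 => /IH; exact: prior_active_sub.
Qed.

(** Confidence radius for the acceptance rate; the factor [lbar] converts it into a radius for the
    utility. *)
Definition conf t v : R :=
  Num.sqrt ((8 * phase t)%:R / (2 + plays (h t) v)%:R).

Lemma radius_path t v : Defs.radius lbar (h t) v = lbar * conf t v.
Proof. by rewrite /Defs.radius size_path. Qed.

Lemma conf_sqr t v : conf t v ^+ 2 * (2 + plays (h t) v)%:R = (8 * phase t)%:R.
Proof.
rewrite /conf sqr_sqrtr; last by rewrite divr_ge0.
by rewrite divfK// pnatr_eq0.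
Qed.

Lemma conf_unplayed_ge1 t v : plays (h t) v = 0%N -> 1 <= conf t v.
Proof.
move=> p0; have := conf_sqr t v; rewrite p0 => c2.
have : 1 <= conf t v ^+ 2.
  have : 1 <= (phase t)%:R :> R by rewrite ler1n phase_gt0.
  by move: c2; rewrite natrM addn0; lra.
by rewrite expr_ge1// sqrtr_ge0.
Qed.

Lemma active_covers t eta : L eta ->
  exists2 v, S (h t) v & D eta v <= Defs.radius lbar (h t) v.
Proof.
have [_ D0 _ _] := metricD; move=> Leta.
case: (activationP t) => [[-> cov]|[v [Lv ncov ->]]].
  by have [v Sv [_ Dv]] := cov _ Leta; exists v.
exists v; first by left.
apply: le_trans (D_le1 Leta Lv) _; rewrite radius_path.
have [p0|p_gt0] := posnP (plays (h t) v).
  by rewrite mulr_ege1// conf_unplayed_ge1.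
(* A point already played in the phase was active before, and it would cover itself. *)
exfalso; apply: ncov; exists v; first exact: played_prior_active.
split => //; rewrite (D0 v v Lv Lv).2// radius_path mulr_ge0 ?sqrtr_ge0//.
exact: le_trans ler01 lbar_ge1.
Qed.

(** * Optimism at clean rounds *)

Variables (U al : R -> R) (Us : R).
Hypothesis U_F : forall v, L v -> U v = F v (al v).
Hypothesis U01 : forall v, L v -> 0 <= U v <= 1.
Hypothesis al01 : forall v, L v -> 0 <= al v <= 1.
Hypothesis U_lip : forall v w, L v -> L w -> `|U v - U w| <= D v w.
Hypothesis F_lip : forall v a a', L v -> 0 <= a <= 1 -> 0 <= a' <= 1 ->
  `|F v a - F v a'| <= lbar * `|a - a'|.
Hypothesis Us_ub : forall v, L v -> U v <= Us.
Hypothesis Us_lub : forall r, r < Us -> exists2 v, L v & r < U v.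
Hypothesis Us_le1 : Us <= 1.

Definition clean t := forall v, L v ->
  `|alpha_hat (h t) v - al v| <= conf t v.

Lemma alpha_hat01 t v : 0 <= @alpha_hat R (h t) v <= 1.
Proof.
rewrite /alpha_hat; case: ifP => [p0|_]; last by rewrite lexx ler01.
rewrite divr_ge0//= ler_pdivrMr ?ltr0n// mul1r ler_nat.
exact: accepted_plays_le.
Qed.

(** The Lipschitz property of [F v] transfers the error on the acceptance rate, and clipping to
    [[0, 1]] cannot increase the distance to [U v], which lies there. *)
Lemma U_hat_close t v : clean t -> L v ->
  `|U_hat F (h t) v - U v| <= Defs.radius lbar (h t) v.
Proof.
move=> cl Lv; have /andP[U0 U1] := U01 Lv.
have : `|F v (alpha_hat (h t) v) - U v| <= Defs.radius lbar (h t) v.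
  rewrite U_F//; apply: le_trans (F_lip Lv (alpha_hat01 _ _) (al01 Lv)) _.
  rewrite radius_path ler_wpM2l ?cl//; exact: le_trans ler01 lbar_ge1.
rewrite /U_hat; set f := F v _; rewrite !ler_norml => /andP[f1 f2].
rewrite /Num.min /Num.max.
by case: ifP => [|/negbT]; case: ifP => [|/negbT]; rewrite -?leNgt; lra.
Qed.

Lemma gap_threshold_le t : clean t ->
  Us - U (arm t) <= 3%:R * Defs.radius lbar (h t) (arm t).
Proof.
move=> cl; have [_ Se best] := zoom (h t).
(* The supremum [Us] may not be attained, so a threshold [eta] with utility above the index is
   refuted: an active [v] covering [eta] has index at least [U eta], one radius paying for the
   distance and one for the estimation error. *)
have le_index : Us <= zoom_index F lbar (h t) (arm t).
  rewrite leNgt; apply/negP => /Us_lub [eta Leta].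
  rewrite ltNge => /negP; apply.
  have [v Sv Dv] := active_covers t Leta; have Lv := active_sub Sv.
  apply: le_trans (best _ Sv); rewrite /zoom_index.
  have := U_hat_close cl Lv; have := U_lip Leta Lv.
  by rewrite !ler_norml => /andP[_ ?] /andP[? _]; lra.
have := U_hat_close cl (threshold_in t).
by move: le_index; rewrite /zoom_index ler_norml => ? /andP[_ ?]; lra.
Qed.


(** A threshold is designated by the round of its first play in the phase; its accumulated noise is
    then the number of plays times the error of its empirical rate. *)
Lemma clean_no_deviation t :
  (forall s (b : bool), (phase_start t <= s < t)%N ->
    let n := (\sum_(s <= r < t) (arm r == arm s))%N in (0 < n)%N ->
    (-1) ^+ b * \sum_(s <= r < t)
        (if arm r == arm s then (z r)%:R - al (arm r) else 0) <=
      n%:R * Num.sqrt ((8 * phase t)%:R / (2 + n)%:R)) -> clean t.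
Proof.
move=> nodev v Lv; have /andP[a0 a1] := al01 Lv.
(* An unplayed threshold has empirical rate 0 by convention, and its radius is at least 1. *)
have [p0|p_gt0] := posnP (plays (h t) v).
  rewrite /alpha_hat p0/= sub0r normrN ger0_norm//.
  exact: le_trans a1 (conf_unplayed_ge1 p0).
have ex_play : exists r, (phase_start t <= r < t)%N && (arm r == v).
  apply: contrapT => no_play; move: p_gt0.
  rewrite plays_path big_nat big1// => r rP; case: eqP => // armr.
  by exfalso; apply: no_play; exists r; rewrite rP armr eqxx.
case: (ex_minnP ex_play) => s /andP[sP /eqP arms] s_min.
have /andP[start_s st] := sP.
have before r : (phase_start t <= r < s)%N -> (arm r == v) = false.
  move=> /andP[r1 r2]; apply/negP => rv.
  have := s_min r; rewrite r1 rv (ltn_trans r2 st) leqNgt r2 => /(_ isT).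
  by [].
have playsE : plays (h t) v = (\sum_(s <= r < t) (arm r == arm s))%N.
  rewrite plays_path (big_cat_nat start_s (ltnW st))/= arms.
  by rewrite big_nat big1// => r /before ->.
have accE : accepted_plays (h t) v =
    (\sum_(s <= r < t) ((arm r == arm s) && z r))%N.
  rewrite accepted_plays_path (big_cat_nat start_s (ltnW st))/= arms.
  by rewrite big_nat big1// => r /before ->.
have noiseE : \sum_(s <= r < t)
    (if arm r == arm s then (z r)%:R - al (arm r) else 0) =
    (accepted_plays (h t) v)%:R - (plays (h t) v)%:R * al v.
  rewrite playsE accE !natr_sum mulr_suml -sumrB; apply: eq_bigr => r _.
  case: eqP => [->|_]/=; last by rewrite mul0r subrr.
  by rewrite mul1r arms.
have n0 : 0 < (plays (h t) v)%:R :> R by rewrite ltr0n.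
rewrite /alpha_hat p_gt0.
have -> : (accepted_plays (h t) v)%:R / (plays (h t) v)%:R - al v =
    ((accepted_plays (h t) v)%:R - (plays (h t) v)%:R * al v) /
    (plays (h t) v)%:R by rewrite mulrBl mulrAC divff ?gt_eqF// mul1r.
rewrite normrM normfV (gtr0_norm n0) ler_pdivrMr// [leRHS]mulrC.
have n_gt0 := p_gt0; rewrite playsE in n_gt0.
have := nodev s true sP n_gt0; have := nodev s false sP n_gt0.
rewrite noiseE -playsE -/(conf t v) expr0 expr1 mul1r mulN1r => dev0 dev1.
by rewrite ler_norml dev0 andbT lerNl.
Qed.

(** * Regret of a clean phase [i], made of the rounds from [a] to [b - 1] *)

Variables (i : nat) (i_gt0 : (0 < i)%N).
Local Notation a := (2 ^ i - 2)%N.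
Local Notation b := (2 ^ i.+1 - 2)%N.
Hypothesis clean_phase : forall t, (a <= t < b)%N -> clean t.

Let two_le : (2 <= 2 ^ i)%N.
Proof. by rewrite -{1}(expn1 2) leq_exp2l. Qed.

Let ab : (a < b)%N.
Proof. by rewrite expnS; lia. Qed.

Let b_pred : (a <= b.-1 < b)%N.
Proof. by move: two_le; rewrite expnS; lia. Qed.

Let in_phase t : (a <= t < b)%N -> phase t = i.
Proof.
move=> /andP[at_ tb]; apply: phase_eq; move: two_le at_ tb; rewrite expnS; lia.
Qed.

Let in_phase_start t : (a <= t < b)%N -> phase_start t = a.
Proof. by move=> /in_phase; rewrite /phase_start => ->. Qed.

Definition phase_plays t u : nat := \sum_(a <= r < t) (arm r == u).

Let plays_phase t u : (a <= t < b)%N -> plays (h t) u = phase_plays t u.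
Proof. by move=> tP; rewrite plays_path in_phase_start. Qed.

Let gap01 u : L u -> 0 <= Us - U u <= 1.
Proof.
by move=> Lu; have := Us_ub Lu; have /andP[] := U01 Lu; move: Us_le1; lra.
Qed.

Let i_ge1 : 1 <= i%:R :> R.
Proof. by rewrite ler1n. Qed.

Let lbar2_ge1 : 1 <= lbar ^+ 2.
Proof. by rewrite expr_ge1// (le_trans ler01 lbar_ge1). Qed.

Let lbar2i_ge1 : 1 <= lbar ^+ 2 * i%:R.
Proof. exact: mulr_ege1. Qed.

(** The left side moves only when [u] is played, and then the gap is at most three radii, with
    [9 * 8 = 72]. The shift [1 +] after a play matches the [2 +] of the radius before it. *)
Lemma phase_plays_gap t u : (a <= t <= b)%N -> L u ->
  (1 + phase_plays t u)%:R * (Us - U u) ^+ 2 <= 72%:R * lbar ^+ 2 * i%:R.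
Proof.
move=> /andP[at_ tb] Lu; move: tb; rewrite -(subnKC at_).
elim: (t - a)%N => [_|k IH tb].
  rewrite addn0 /phase_plays big_geq// addn0 mul1r.
  have : (Us - U u) ^+ 2 <= 1 by rewrite expr_le1//; case/andP: (gap01 Lu).
  by move: lbar2i_ge1; lra.
rewrite addnS /phase_plays big_nat_recr ?leq_addr//= -/(phase_plays _ _).
have tP : (a <= a + k < b)%N by rewrite leq_addr -addnS.
case: eqP => [armE|_]; last by rewrite addn0 IH// ltnW// -addnS.
have := gap_threshold_le (clean_phase tP); rewrite armE radius_path => gap_le.
have := conf_sqr (a + k) u; rewrite (in_phase tP) plays_phase//.
rewrite natrM => confE.
have gap2 : (Us - U u) ^+ 2 <= (3%:R * (lbar * conf (a + k) u)) ^+ 2.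
  have /andP[g0 _] := gap01 Lu.
  by rewrite lerXn2r// nnegrE// (le_trans g0).
have -> : (1 + (phase_plays (a + k) u + true) = 2 + phase_plays (a + k) u)%N.
  by rewrite addn1.
apply: (le_trans (ler_wpM2l (ler0n _ _) gap2)).
rewrite !exprMn.
have -> : (2 + phase_plays (a + k) u)%:R * (3%:R ^+ 2 * (lbar ^+ 2 * conf (a + k) u ^+ 2)) =
  9%:R * lbar ^+ 2 * (conf (a + k) u ^+ 2 * (2 + phase_plays (a + k) u)%:R) :> R.
  by ring.
by rewrite confE; lra.
Qed.

(** Sixteen squared radii times [2 + N] make [128 lbar^2 i], while the squared gap times [2 + N] is
    at most [72 lbar^2 i + 1]. *)
Lemma gap_radius_le t u : (a <= t < b)%N -> L u ->
  (Us - U u) / 4%:R <= Defs.radius lbar (h t) u.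
Proof.
move=> tP Lu; have /andP[g0 g1] := gap01 Lu.
have r0 : 0 <= Defs.radius lbar (h t) u.
  by rewrite radius_path mulr_ge0 ?sqrtr_ge0// (le_trans ler01 lbar_ge1).
have tP' : (a <= t <= b)%N by case/andP: tP => -> /ltnW ->.
have := phase_plays_gap tP' Lu; have := conf_sqr t u.
rewrite (in_phase tP) plays_phase// natrM; set N := phase_plays t u => confE gapN.
suff : (Us - U u) ^+ 2 <= (4%:R * Defs.radius lbar (h t) u) ^+ 2.
  have r40 : 0 <= 4%:R * Defs.radius lbar (h t) u by rewrite mulr_ge0.
  by rewrite ler_sqr ?nnegrE// => gap_le; rewrite ler_pdivrMr// mulrC.
have N2 : 0 < (2 + N)%:R :> R by rewrite ltr0n.
rewrite -(ler_pM2r N2) radius_path !exprMn.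
have -> : 4%:R ^+ 2 * (lbar ^+ 2 * conf t u ^+ 2) * (2 + N)%:R =
  16%:R * lbar ^+ 2 * (conf t u ^+ 2 * (2 + N)%:R) :> R by ring.
rewrite confE; have g2 : (Us - U u) ^+ 2 <= 1 by rewrite expr_le1.
have -> : (2 + N)%:R = (1 + N)%:R + 1 :> R by rewrite addSn -natr1.
by rewrite mulrDr mulr1 [X in X + _]mulrC; move: lbar2i_ge1; lra.
Qed.

(** The disjunction leaves open which point was activated first: the later one lies outside the ball
    of the earlier one, whose gap sets the distance. *)
Definition separated (A : set R) := forall u v, A u -> A v -> u <> v ->
  (Us - U u) / 4%:R < D u v \/ (Us - U v) / 4%:R < D u v.

Lemma active_separated t : (a <= t < b)%N -> separated (S (h t)).
Proof.
have [_ _ Dsym _] := metricD.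
have step r : (a <= r < b)%N -> separated (prior_active S (h r)) ->
    separated (S (h r)).
  move=> rP sepA; have prior_sub x : prior_active S (h r) x -> L x.
    by move=> /prior_active_sub; exact: active_sub.
  case: (activationP r) => [[-> _]//|[v [Lv ncov ->]]].
  have far u : prior_active S (h r) u -> (Us - U u) / 4%:R < D v u.
    move=> Au; rewrite ltNge; apply/negP => Dle; apply: ncov; exists u => //.
    split => //; apply: le_trans Dle _; exact: gap_radius_le (prior_sub _ Au).
  move=> x w [->|Ax] [->|Aw] xw //.
  - by right; exact: far.
  - by left; rewrite Dsym//; [exact: far|exact: prior_sub].
  - exact: sepA.
move=> /andP[at_ tb]; move: tb; rewrite -(subnKC at_).
elim: (t - a)%N => [|k IH] tb.
  have aP : (a <= a + 0 < b)%N by rewrite addn0 leqnn.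
  by apply: step => //; rewrite prior_active_start// in_phase_start// addn0.
have kP : (a <= a + k < b)%N by rewrite leq_addr/= (leq_trans _ tb)// addnS.
have kP' : (a <= a + k.+1 < b)%N by rewrite leq_addr/=.
apply: step => //; rewrite addnS prior_activeS; first by apply: IH; case/andP: kP.
by rewrite -addnS !in_phase.
Qed.

(** Active sets grow within a phase, so the separation of the last one applies to all thresholds
    played in the phase. *)
Lemma threshold_active t : (a <= t < b)%N -> S (h b.-1) (arm t).
Proof.
move=> /andP[at_ tb].
have tb' : (t <= b.-1)%N by lia.
have : S (h t) (arm t) by case: (zoom (h t)).
suff : S (h t) `<=` S (h b.-1) by exact.
rewrite -(subnKC tb'); have : (t + (b.-1 - t) < b)%N by lia.
elim: (b.-1 - t)%N => [|k IH] kb; first by rewrite addn0.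
apply: subset_trans (IH _) _; first by lia.
rewrite addnS -prior_activeS; first exact: prior_active_sub.
by rewrite !in_phase//; lia.
Qed.

Variables (Cz dz : R).
Hypothesis Cz_gt0 : 0 < Cz.
Hypothesis dz_ge0 : 0 <= dz.
Hypothesis zdim : zooming_dimension L D (fun u => Us - U u) Cz dz.

Definition level (r : R) u : bool := r / 2%:R < Us - U u <= r.

Lemma level_plays r : 0 < r <= 1 ->
  (\sum_(a <= t < b) level r (arm t))%:R * r ^+ 2 <=
    Cz * r `^ (- dz) * (288%:R * lbar ^+ 2 * i%:R).
Proof.
move=> r01; have [n [A [n_le _ A_diam A_cover]]] := zdim r01.
have r0 : 0 < r by case/andP: r01.
pose vs := undup [seq arm t | t <- index_iota a b & level r (arm t)].
have vsP v : v \in vs -> exists2 t, (a <= t < b)%N & level r v /\ v = arm t.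
  rewrite mem_undup => /mapP[t]; rewrite mem_filter mem_index_iota.
  by move=> /andP[lt tP] ->; exists t.
have vsL v : v \in vs -> L v.
  by move=> /vsP[t _ [_ ->]]; exact: threshold_in.
have sz : (size vs <= n)%N.
  have [->//|[v0 v0vs]] : vs = [::] \/ exists v0, v0 \in vs.
    by case: (vs) => [|v0 s]; [left|right; exists v0; rewrite mem_head].
  have cover v : v \in vs -> exists k, A k v.
    move=> vvs; have [t tP [lv _]] := vsP v vvs.
    have [k _ Akv] : (\bigcup_k A k) v by apply: A_cover; split; [exact: vsL|].
    by exists k.
  have [k0 _] : exists k, A k v0 by exact: cover.
  (* Each played threshold of the level is sent to a covering set containing it; injectivity of this
     choice bounds their number by [n]. *)
  pose f v := xget k0 [set k | A k v].
  have fP v : v \in vs -> A (f v) v.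
    by move=> /cover[k Ak]; exact: (@xgetPex _ k0 [set k | A k v]) (ex_intro _ k Ak).
  apply: (@leq_trans (size (enum 'I_n))); last by rewrite size_enum_ord.
  rewrite -(size_map f); apply: uniq_leq_size; last first.
    by move=> k _; rewrite mem_enum.
  rewrite map_inj_in_uniq ?undup_uniq// => u v uvs vvs fuv.
  apply/eqP; apply/negPn/negP => /eqP uv.
  have Duv : D u v <= r / 8%:R.
    by apply: A_diam (fP u uvs) _; rewrite fuv; exact: fP.
  have [s sP [lu uE]] := vsP u uvs; have [t tP [lv vE]] := vsP v vvs.
  have Su : S (h b.-1) u by rewrite uE; exact: threshold_active.
  have Sv : S (h b.-1) v by rewrite vE; exact: threshold_active.
  move: lu lv; rewrite /level => /andP[lu _] /andP[lv _].
  by case: (active_separated b_pred Su Sv uv); lra.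
have count_le : (\sum_(a <= t < b) level r (arm t) <=
    \sum_(v <- vs) phase_plays b v)%N.
  rewrite exchange_big/=; rewrite big_seq [leqRHS]big_seq; apply: leq_sum => t.
  rewrite mem_index_iota => tP; case: (boolP (level r (arm t))) => // lt.
  have tvs : arm t \in vs.
    by rewrite mem_undup; apply/mapP; exists t => //; rewrite mem_filter lt mem_index_iota.
  by rewrite (big_rem _ tvs)/= eqxx.
have plays_le v : v \in vs ->
    (phase_plays b v)%:R * r ^+ 2 <= 288%:R * lbar ^+ 2 * i%:R.
  move=> vvs; have [t _ [/andP[lv _] _]] := vsP v vvs.
  have bP : (a <= b <= b)%N by rewrite leqnn andbT ltnW.
  have := phase_plays_gap bP (vsL v vvs); rewrite natrD mulrDl => gapN.
  (* The gap exceeds [r / 2] on this level, so [72] becomes [4 * 72 = 288]. *)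
  have r2 : r ^+ 2 <= 4%:R * (Us - U v) ^+ 2.
    have -> : 4%:R * (Us - U v) ^+ 2 = (2%:R * (Us - U v)) ^+ 2 by ring.
    by rewrite lerXn2r ?nnegrE//; lra.
  have := ler_wpM2l (ler0n R (phase_plays b v)) r2.
  by have := sqr_ge0 (Us - U v); lra.
apply: (@le_trans _ _ (\sum_(v <- vs) (288%:R * lbar ^+ 2 * i%:R))).
  apply: (@le_trans _ _ (\sum_(v <- vs) (phase_plays b v)%:R * r ^+ 2)).
    by rewrite -mulr_suml ler_wpM2r ?sqr_ge0// -natr_sum ler_nat.
  by rewrite big_seq [leRHS]big_seq; apply: ler_sum.
rewrite big_const_seq count_predT iter_addr_0 -[leLHS]mulr_natl.
apply: ler_wpM2r; first by move: lbar2i_ge1; lra.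
by apply: le_trans n_le; rewrite ler_nat.
Qed.

Lemma phase_gap_sum_le (K : nat) :
  \sum_(a <= t < b) (Us - U (arm t)) <= (2 ^ i)%:R * 2 ^- K +
    288%:R * lbar ^+ 2 * i%:R * Cz * (2 ^- K) `^ (- dz) * 2 ^+ K.
Proof.
have dyadic (k : nat) : 0 < (2 ^- k : R) <= 1.
  by rewrite invr_gt0 exprn_gt0//= invf_le1 ?exprn_gt0// exprn_ege1// ler1n.
have split_gap u : L u -> Us - U u <= 2 ^- K +
    \sum_(k < K) 2 ^- k * (level (2 ^- k) u)%:R.
  move=> Lu; have /andP[g0 g1] := gap01 Lu.
  have sum0 (k : nat) : 0 <= \sum_(j < k) 2 ^- j * (level (2 ^- j) u)%:R :> R.
    by apply: sumr_ge0 => j _; rewrite mulr_ge0// ltW//; case/andP: (dyadic j).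
  (* Either the gap is below the finest scale, or it belongs to one of the first [K] levels; gaps
     are at most 1, the scale of level 0. *)
  have : Us - U u <= 2 ^- K \/
      Us - U u <= \sum_(k < K) 2 ^- k * (level (2 ^- k) u)%:R.
    elim: K => [|k [IH|IH]]; first by left; rewrite expr0 invr1.
      have [lo|hi] := leP (Us - U u) (2 ^- k.+1); first by left.
      right; rewrite big_ord_recr/= (_ : level _ _ = true); last first.
        by rewrite /level IH andbT; move: hi; rewrite exprS invfM mulrC.
      by rewrite mulr1; apply: le_trans IH _; rewrite lerDr sum0.
    right; rewrite big_ord_recr/=; apply: le_trans IH _; rewrite lerDl.
    by rewrite mulr_ge0// ltW//; case/andP: (dyadic k).
  by case=> H; apply: le_trans H _; [rewrite lerDl sum0|rewrite lerDr ltW//; case/andP: (dyadic K)].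
apply: (@le_trans _ _ (\sum_(a <= t < b) (2 ^- K +
    \sum_(k < K) 2 ^- k * (level (2 ^- k) (arm t))%:R))).
  by apply: ler_sum => t _; apply: split_gap; exact: threshold_in.
rewrite big_split/= sumr_const_nat; apply: lerD.
  have -> : (b - a = 2 ^ i)%N by move: two_le; rewrite expnS; lia.
  by rewrite -[leLHS]mulr_natl.
rewrite exchange_big/=.
pose B : R := 288%:R * lbar ^+ 2 * i%:R * Cz * (2 ^- K) `^ (- dz).
have B0 : 0 <= B.
  apply: mulr_ge0; last exact: powR_ge0.
  by apply: mulr_ge0; [move: lbar2i_ge1; lra|exact: ltW].
apply: (@le_trans _ _ (\sum_(k < K) B * 2 ^+ k)); last first.
  rewrite -mulr_sumr ler_wpM2l//.
  (* The geometric sum of the [2^k] for [k < K] is at most [2^K]. *)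
  elim: K {B B0 split_gap} => [|k IH]; first by rewrite big_ord0.
  rewrite big_ord_recr/= exprS; move: IH.
  by set s := \sum_(_ < _) _; set q := 2 ^+ k; lra.
apply: ler_sum => k _; rewrite -mulr_sumr -natr_sum.
have /andP[r0 r1] := dyadic k.
have := level_plays (dyadic k); set N := (\sum_(_ <= _ < _) _)%N; move=> N_le.
rewrite -[X in _ <= _ * X]invrK.
rewrite ler_pdivlMr// mulrAC -expr2 mulrC.
apply: le_trans N_le _; rewrite /B.
have -> : Cz * (2 ^- k) `^ (- dz) * (288%:R * lbar ^+ 2 * i%:R) =
  288%:R * lbar ^+ 2 * i%:R * Cz * (2 ^- k) `^ (- dz) by ring.
apply: ler_wpM2l.
  by apply: mulr_ge0; [move: lbar2i_ge1; lra|exact: ltW].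
have K0 : 0 < 2 ^- K :> R by case/andP: (dyadic K).
rewrite !powRN lef_pV2 ?posrE ?powR_gt0//.
rewrite ge0_ler_powR ?nnegrE ?(ltW r0) ?(ltW K0)//.
by rewrite lef_pV2 ?posrE ?exprn_gt0// ler_eXn2l ?ltr1n// ltnW.
Qed.

End zooming_path.

(** * Choice of the dyadic scale *)

(** It rests on [k^2 <= 4 * 2^k], and serves to absorb the number of phases into the square root of
    the horizon. *)
Lemma trunc_log_sqr_le n : (trunc_log 2 n.+1 ^ 2 <= 4 * n.+1)%N.
Proof.
have sqr_le k : (k ^ 2 <= 4 * 2 ^ k)%N.
  have [k3|] := ltnP k 3; first by case: k k3 => [|[|[|]]].
  elim: k => // k IH; rewrite leq_eqVlt => /predU1P[<-//|k3].
  have := IH k3; rewrite !expnS expn0 !muln1; move: (2 ^ k)%N => q; nia.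
apply: leq_trans (sqr_le _) _; rewrite leq_mul2l /=.
by case/andP: (trunc_log_bounds (isT : (1 < 2)%N) (isT : (0 < n.+1)%N)).
Qed.

Section rate.
Variable R : realType.

Lemma ln2_ge : 2^-1 <= ln 2%:R :> R.
Proof.
rewrite -ler_expR lnK ?posrE//.
have -> : expR 2^-1 = (expR (- 2^-1))^-1 :> R by rewrite expRN invrK.
rewrite -[leRHS]invrK lef_pV2 ?posrE ?expR_gt0//.
by apply: le_trans (expR_ge1Dx _); lra.
Qed.

Lemma trunc_log_le_ln (T : nat) : (2 <= T)%N ->
  (trunc_log 2 T.+1)%:R <= 4%:R * ln T%:R :> R.
Proof.
move=> T2; have T0 : 0 < T%:R :> R by rewrite ltr0n; lia.
have /andP[lo _] := trunc_log_bounds (isT : (1 < 2)%N) (isT : (0 < T.+1)%N).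
set I := trunc_log 2 T.+1 in lo *.
have IT : (2 ^ I <= T * T)%N by apply: leq_trans lo _; nia.
have : ln (2 ^+ I) <= ln (T%:R * T%:R) :> R.
  by rewrite ler_ln ?posrE ?exprn_gt0 ?mulr_gt0// -natrX -natrM ler_nat.
rewrite lnXn// lnM ?posrE// -[X in X <= _]mulr_natl.
have := ler_wpM2l (ler0n R I) ln2_ge.
lra.
Qed.

Lemma dyadic_approx (x : R) : 0 < x < 1 -> exists K : nat, x <= 2 ^- K <= 2%:R * x.
Proof.
move=> /andP[x0 x1].
have ex : exists K, (2 ^- K < x).
  exists (Num.truncn x^-1).+1; rewrite invf_plt ?posrE ?exprn_gt0//.
  apply: lt_le_trans (truncnS_gt _) _.
  by rewrite -natrX ler_nat; apply: ltnW; exact: ltn_expl.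
(* The least exponent that goes below [x] is positive since [x < 1]; its predecessor is the
   witness. *)
case: (ex_minnP ex) => -[|K]; first by rewrite expr0 invr1 ltNge (ltW x1).
move=> Kx Kmin; exists K; apply/andP; split.
  by rewrite leNgt; apply/negP => /Kmin; rewrite ltnn.
by move: Kx; rewrite exprS invfM => /ltW; lra.
Qed.

(** If the balancing scale is at least 1, the trivial bound [T] suffices. Otherwise a power [2 ^- K]
    within a factor 2 of it makes the three terms at most 4, [288 * 16] and 24 times the rate, 4636
    in total. *)
Lemma regret_rate (Cz dz lb g reg : R) (T : nat) :
  0 < Cz -> 0 <= dz -> 1 <= lb -> (2 <= T)%N ->
  g <= Cz `^ (dz + 2%:R)^-1 -> reg <= T%:R ->
  (forall K : nat, reg <= 2%:R * T%:R * 2 ^- K +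
      288%:R * lb ^+ 2 * (trunc_log 2 T.+1)%:R ^+ 2 * Cz *
        (2 ^- K) `^ (- dz) * 2 ^+ K +
      2%:R * (trunc_log 2 T.+1)%:R * g) ->
  reg <= 5000%:R * ((Cz * lb ^+ 2 * (ln T%:R) ^+ 2) `^ (dz + 2%:R)^-1
           * T%:R `^ ((dz + 1) / (dz + 2%:R))).
Proof.
move=> Cz0 dz0 lb1 T2 g_le reg_le_T reg_le.
set p := (dz + 2%:R)^-1.
have d2 : 0 < dz + 2%:R by lra.
have p0 : 0 < p by rewrite invr_gt0.
have p1 : p <= 2^-1 by rewrite lef_pV2 ?posrE//; lra.
have T0 : 0 < T%:R :> R by rewrite ltr0n; lia.
have T1 : 1 <= T%:R :> R by rewrite ler1n; lia.
have lnT : 2^-1 <= ln T%:R :> R.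
  by apply: le_trans ln2_ge _; rewrite ler_ln ?posrE// ler_nat.
set l := ln T%:R in lnT *.
set A := Cz * lb ^+ 2 * l ^+ 2.
have lb2 : 1 <= lb ^+ 2 by rewrite expr_ge1//; lra.
have l2 : 4^-1 <= l ^+ 2 by nra.
have c0 : 4^-1 <= lb ^+ 2 * l ^+ 2 by nra.
have A0 : 0 < A by rewrite /A -mulrA mulr_gt0//; lra.
(* [x] balances [T x] and [A x ^ - (dz + 1)]; the claimed rate is [x T]. *)
pose x := (A / T%:R) `^ p.
have x0 : 0 < x by rewrite powR_gt0// divr_gt0.
have pE : (dz + 1) / (dz + 2%:R) = 1 - p.
  by rewrite /p; field; rewrite gt_eqF.
have rateE : A `^ p * T%:R `^ ((dz + 1) / (dz + 2%:R)) = x * T%:R.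
  rewrite /x powRM ?ltW ?invr_gt0// pE powRD; last first.
    by apply/implyP => _; rewrite gt_eqF.
  rewrite powRr1 ?ltW// -powR_inv1 ?ltW// -powRrM mulN1r.
  by rewrite -!mulrA; congr (_ * _); rewrite mulrC.
rewrite rateE.
have xT0 : 0 < x * T%:R by rewrite mulr_gt0.
have [x_ge1|x_lt1] := leP 1 x.
  by apply: le_trans reg_le_T _; nra.
have [|K /andP[xK Kx]] := @dyadic_approx x; first by rewrite x0.
have := reg_le K; set I := trunc_log 2 T.+1.
set eps : R := 2 ^- K in xK Kx *.
have eps0 : 0 < eps by rewrite invr_gt0 exprn_gt0.
have -> : 2 ^+ K = eps^-1 :> R by rewrite invrK.
have I_ln : I%:R <= 4%:R * l by exact: trunc_log_le_ln.
have I2 : I%:R ^+ 2 <= 16%:R * l ^+ 2.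
  by have := ler0n R I; nra.
have main : lb ^+ 2 * I%:R ^+ 2 * Cz * eps `^ (- dz) * eps^-1 <=
    16%:R * (x * T%:R).
  (* This is the balance equation [x^(dz + 2) = A / T]. *)
  have -> : x * T%:R = A * (x `^ (- dz) * x^-1).
    have xA : A = x `^ dz * x * x * T%:R.
      have : x `^ (dz + 2%:R) = A / T%:R.
        by rewrite /x -powRrM mulVf ?gt_eqF// powRr1// divr_ge0 ?ltW.
      rewrite powRD; last by apply/implyP => _; rewrite gt_eqF.
      rewrite powR_mulrn ?ltW// expr2 mulrA => ->.
      by rewrite divfK ?gt_eqF.
    rewrite xA powRN; have : x `^ dz != 0 by rewrite (gt_eqF (powR_gt0 dz x0)).
    move: (x `^ dz) => q q0; field.
    by rewrite q0 gt_eqF.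
  have e1 : eps `^ (- dz) * eps^-1 <= x `^ (- dz) * x^-1.
    rewrite !powRN; apply: ler_pM.
    - by rewrite invr_ge0 powR_ge0.
    - by rewrite invr_ge0 ltW.
    - rewrite lef_pV2 ?posrE ?(powR_gt0 dz x0) ?(powR_gt0 dz eps0)//.
      by apply: ge0_ler_powR; rewrite ?nnegrE ?(ltW x0) ?(ltW eps0).
    - by rewrite lef_pV2 ?posrE.
  have e0 : 0 <= eps `^ (- dz) * eps^-1 by rewrite mulr_ge0 ?powR_ge0 ?invr_ge0 ?ltW.
  rewrite -mulrA mulrA.
  have : lb ^+ 2 * I%:R ^+ 2 * Cz <= 16%:R * A.
    rewrite /A; have : 0 <= lb ^+ 2 * Cz by rewrite mulr_ge0 ?ltW//; lra.
    by move=> /ler_wpM2l /(_ _ _ I2); lra.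
  move=> AI.
  rewrite -[leLHS]mulrA; apply: (@le_trans _ _ (16%:R * A * (eps `^ (- dz) * eps^-1))).
    by rewrite ler_wpM2r.
  by rewrite -mulrA !ler_wpM2l// ltW.
(* The number of phases is at most [3 sqrt T], and [sqrt T] is at most [T^(1 - p)] as [p <= 1/2].
   The remaining factor [(lb^2 l^2)^p] of the rate is at least 1/4, whence [3 * 4]. *)
have tail : I%:R * g <= 12%:R * (x * T%:R).
  have I_sqrt : I%:R <= 3%:R * Num.sqrt T%:R :> R.
    rewrite -ler_sqr ?nnegrE ?mulr_ge0 ?sqrtr_ge0// exprMn sqr_sqrtr//.
    have := trunc_log_sqr_le T; rewrite -(ler_nat R) natrX natrM -natr1 => ?.
    have T2R : 2%:R <= T%:R :> R by rewrite ler_nat.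
    by rewrite -/I; lra.
  have cp : 4^-1 <= (lb ^+ 2 * l ^+ 2) `^ p.
    have [c1|c1] := leP 1 (lb ^+ 2 * l ^+ 2).
      apply: (@le_trans _ _ 1); first by lra.
      by rewrite -[leLHS](powRr0 (lb ^+ 2 * l ^+ 2)) ler_powR// ltW.
    apply: (le_trans c0); apply: ger1_powR; last by lra.
    by rewrite (ltW c1) andbT (lt_le_trans _ c0).
  have Tp : Num.sqrt T%:R <= T%:R `^ (1 - p) :> R.
    by rewrite -powR12_sqrt// ler_powR//; lra.
  have cnn : 0 <= lb ^+ 2 * l ^+ 2 by lra.
  rewrite -rateE pE /A -(mulrA Cz) (powRM _ (ltW Cz0) cnn).
  set G := Cz `^ p in g_le *.
  have G0 : 0 <= G by exact: powR_ge0.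
  have h1 : I%:R * g <= 3%:R * Num.sqrt T%:R * G.
    apply: (@le_trans _ _ (I%:R * G)); first by rewrite ler_wpM2l.
    by rewrite ler_wpM2r.
  apply: le_trans h1 _.
  have h2 : 4^-1 * Num.sqrt T%:R <= (lb ^+ 2 * l ^+ 2) `^ p * T%:R `^ (1 - p).
    by rewrite ler_pM// sqrtr_ge0.
  by have := ler_wpM2l G0 h2; lra.
have -> : 288%:R * lb ^+ 2 * I%:R ^+ 2 * Cz * eps `^ (- dz) * eps^-1 =
  288%:R * (lb ^+ 2 * I%:R ^+ 2 * Cz * eps `^ (- dz) * eps^-1) by ring.
have := ler_wpM2l (ltW T0) Kx.
lra.
Qed.
End rate.

(* No measurability is required: the gap of a random threshold need not be
   measurable. *)
Lemma ge0_le_integral_pointwise d (T : measurableType d) (R : realType)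
    (mu : {measure set T -> \bar R}) (f g : T -> \bar R) :
  (forall x, 0 <= f x)%E -> (forall x, f x <= g x)%E ->
  (\int[mu]_x f x <= \int[mu]_x g x)%E.
Proof.
move=> f0 fg; have g0 x : (0 <= g x)%E by exact: le_trans (fg x).
rewrite !ge0_integralTE//; apply: ereal_sup_le => _ [k kf <-].
by exists k => // x; apply: le_trans (fg x).
Qed.

(** At the scale [x = Gamma u] the level contains [u], so its cover is nonempty and [x^dz <= Cz];
    then [x^(dz + 2) <= Cz] because [x <= 1]. *)
Lemma gap_le_zooming_constant (R : realType) (L : set R) (D : R -> R -> R)
    (Gamma : R -> R) (Cz dz : R) u : 0 < Cz -> 0 <= dz ->
  zooming_dimension L D Gamma Cz dz -> L u -> Gamma u <= 1 ->
  Gamma u <= Cz `^ (dz + 2%:R)^-1.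
Proof.
move=> Cz0 dz0 zdim Lu g1; set x := Gamma u in g1 *.
have [x0|x0] := leP x 0; first exact: le_trans x0 (powR_ge0 _ _).
have [|n [A [n_le _ _ cov]]] := zdim x; first by rewrite x0.
have [k _ _] : (\bigcup_k A k) u.
  by apply: cov; split => //; rewrite lexx andbT -/x; lra.
have n1 : 1 <= n%:R :> R by rewrite ler1n; case: n k {A n_le cov} => [[]|].
have xCz : x `^ dz <= Cz.
  have := le_trans n1 n_le; rewrite powRN ler_pdivlMr ?mul1r//.
  exact: powR_gt0.
have d2 : 0 < dz + 2%:R by lra.
have -> : x = (x `^ (dz + 2%:R)) `^ (dz + 2%:R)^-1.
  by rewrite -powRrM divff ?gt_eqF// powRr1// ltW.
apply: ge0_ler_powR; rewrite ?nnegrE ?powR_ge0 ?invr_ge0 ?(ltW Cz0) ?(ltW d2)//.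
apply: le_trans xCz; rewrite powRD; last by apply/implyP => _; rewrite gt_eqF.
rewrite -[leRHS]mulr1 ler_wpM2l ?powR_ge0// powR_mulrn ?(ltW x0)//.
by rewrite expr_le1 ?(ltW x0).
Qed.

Lemma sum_phases (R : realType) (f : nat -> R) (I : nat) :
  \sum_(0 <= t < 2 ^ I.+1 - 2) f t =
  \sum_(1 <= i < I.+1) \sum_(2 ^ i - 2 <= t < 2 ^ i.+1 - 2) f t.
Proof.
elim: I => [|I IH]; first by rewrite !big_geq.
rewrite big_nat_recr//= -IH -big_cat_nat//=.
by rewrite leq_sub2r// leq_exp2l.
Qed.

Lemma sum_pow2 (I : nat) : (\sum_(1 <= i < I.+1) 2 ^ i = 2 ^ I.+1 - 2)%N.
Proof.
elim: I => [|I IH]; first by rewrite big_geq.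
have : (2 <= 2 ^ I.+1)%N by rewrite -{1}(expn1 2) leq_exp2l.
by rewrite big_nat_recr//= IH [in RHS]expnS; lia.
Qed.

(** * Expected regret *)

Section repeated.
Variables (R : realType) (G : game R) (gstar : R -> pdf R) (pi : policy R).
Context d (Omega : measurableType d) (P : probability Omega R).
Variables (Y : nat -> Omega -> R * R) (g : nat -> Omega -> pdf R).
Hypothesis play : repeated_game G gstar pi P Y g.
Local Notation e := (eta_ G pi Y).
Local Notation z := (Z_ G pi Y).
Local Notation al := (fun t w => accept_prob G gstar (e t w)).

Definition past_gen t : set (set Omega) :=
  [set E | exists s (B : set R),
     [/\ (s <= t)%N, measurable B & E = e s @^-1` B]] `|`
  [set E | exists s (V : set (R * R)),
     [/\ (s < t)%N, measurable V & E = Y s @^-1` V]] `|`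
  [set E | exists2 s, (s < t)%N & E = [set w | z s w]].

Lemma past_gen_measurable t : past_gen t `<=` measurable.
Proof.
have [[mY meta] _ _ _] := play.
move=> E [[[s [B [_ mB ->]]]|[s [V [_ mV ->]]]]|[s _ ->]].
- by rewrite -[X in measurable X]setTI; exact: meta.
- by rewrite -[X in measurable X]setTI; exact: mY.
have : measurable_fun setT (z s).
  rewrite /Z_ /accepts; apply: measurable_fun_ler.
    apply: (@measurableT_comp _ _ _ _ _ _ (@Num.norm R R)) => //.
    by apply: measurable_funB; exact: measurableT_comp.
  exact: measurable_funM.
by move=> /(_ measurableT [set true]); rewrite setTI; apply.
Qed.

Lemma past_gen_eta r t : (r <= t)%N ->
  measurable_fun (setT : set (g_sigma_algebraType (past_gen t))) (e r).
Proof.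
move=> rt _ B mB; rewrite setTI; apply: sub_sigma_algebra.
by left; left; exists r, B.
Qed.

(** Being a version of a conditional expectation, the acceptance probability of round [r] is
    measurable for the past of [r], and pasts increase. *)
Lemma past_gen_accept_prob r t : (r <= t)%N ->
  measurable_fun (setT : set (g_sigma_algebraType (past_gen t))) (al r).
Proof.
have [_ _ _ cond] := play.
move=> rt _ B mB; rewrite setTI.
have [/(_ B mB) + _] := cond r.
rewrite -/(past_gen r); apply: sub_smallest2r; first exact: smallest_sigma_algebra.
move=> E [[[s [C [sr mC ->]]]|[s [V [sr mV ->]]]]|[s sr ->]].
- by left; left; exists s, C; split => //; exact: leq_trans rt.
- by left; right; exists s, V; split => //; exact: leq_trans rt.
- by right; exists s => //; exact: leq_trans rt.
Qed.

Lemma past_gen_accepted r t : (r < t)%N ->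
  measurable_fun (setT : set (g_sigma_algebraType (past_gen t))) (z r).
Proof.
move=> rt; apply: (@measurable_fun_bool _ _ _ _ true); rewrite setTI.
by apply: sub_sigma_algebra; right; exists r.
Qed.

Lemma accept_prob_cond t E : <<s past_gen t >> E ->
  (\int[P]_(w in E) (accept_prob G gstar (e t w))%:E =
   \int[P]_(w in E) (z t w)%:R%:E)%E.
Proof. by have [_ _ _ cond] := play; have [_] := cond t; apply. Qed.

(** First play and current round, both counted from the start of the phase, number of plays minus
    one, and sign of the deviation. *)
Definition dev_index (i : nat) : finType :=
  ('I_(2 ^ i) * 'I_(2 ^ i) * 'I_(2 ^ i) * bool)%type.

Definition dev (i : nat) (j : dev_index i) : set Omega :=
  let: (s, t, n, b) := j in
  deviation e al z (Num.sqrt ((8 * i)%:R / (2 + n.+1)%:R))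
    (2 ^ i - 2 + s) (2 ^ i - 2 + t) n.+1 b.

(* A sum of indicators rather than the indicator of the union, so that the
   union bound is linearity of the integral. *)
Definition bad (i : nat) (w : Omega) : R := \sum_(j : dev_index i) \1_(dev j) w.

Lemma measurable_dev i (j : dev_index i) : measurable (dev j).
Proof.
case: j => [[[s t] n] b].
apply: measurable_deviation.
- exact: past_gen_measurable.
- exact: past_gen_eta.
- exact: past_gen_accept_prob.
- exact: past_gen_accepted.
Qed.

Lemma bad_ge0 i w : 0 <= bad i w.
Proof. by apply: sumr_ge0 => j _. Qed.

Lemma measurable_bad i : measurable_fun setT (bad i).
Proof. by apply: measurable_sum => j; apply: measurable_indic; exact: measurable_dev. Qed.

Lemma integral_bad_le i : (0 < i)%N ->
  (\int[P]_w (bad i w)%:E <= (2%:R / (2 ^ i)%:R)%:E)%E.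
Proof.
move=> i0.
rewrite (eq_integral (fun w => (\sum_(j <- index_enum (dev_index i)) (\1_(dev j) w)%:E)%E)); last first.
  by move=> w _; rewrite /bad -sumEFin.
rewrite ge0_integral_sum; first last.
- by move=> j w _; rewrite lee_fin.
- by move=> j; apply/measurable_EFinP; apply: measurable_indic; exact: measurable_dev.
- by [].
have dev_le (j : dev_index i) :
    (\int[P]_w (\1_(dev j) w)%:E <= (expR (- (3%:R * i%:R)))%:E)%E.
  rewrite integral_indic ?setIT//; last exact: measurable_dev.
  case: j => [[[s t] n] b]; apply: deviation_sqrt_le => //.
  - exact: past_gen_measurable.
  - exact: past_gen_eta.
  - exact: past_gen_accept_prob.
  - exact: past_gen_accepted.
  - by move=> *; exact: PA_ge0_le1.
  - exact: accept_prob_cond.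
apply: (@le_trans _ _ (\sum_(j : dev_index i) (expR (- (3%:R * i%:R)))%:E)%E).
  by apply: lee_sum.
rewrite sumEFin lee_fin sumr_const.
have -> : #|{: dev_index i}| = (2 ^ i * 2 ^ i * 2 ^ i * 2)%N.
  by rewrite !card_prod !card_ord card_bool.
(* There are [2 * 8^i] events of probability at most [expR (- 3 i)], so the bound [2 / 2^i] needs
   [16 <= expR 3]; it follows from [(9/8)^8 >= 64/25] and [(64/25)^3 >= 16]. *)
have e1 : 64%:R / 25%:R <= expR 1 :> R.
  have -> : 1 = 1 / 8%:R * 8%:R :> R by lra.
  rewrite expRM_natr; apply: (@le_trans _ _ ((1 + 1 / 8%:R) ^+ 8)); first by lra.
  by rewrite lerXn2r ?nnegrE ?expR_ge0 ?expR_ge1Dx//; lra.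
have e3 : 16%:R <= expR 3%:R :> R.
  have -> : 3%:R = 1 * 3%:R :> R by rewrite mul1r.
  rewrite expRM_natr; apply: (@le_trans _ _ ((64%:R / 25%:R) ^+ 3)); first by lra.
  by rewrite lerXn2r ?nnegrE ?expR_ge0//; lra.
have q4 : (2 ^ i)%:R ^+ 4 <= expR (3%:R * i%:R) :> R.
  rewrite expRM_natr; apply: (@le_trans _ _ (16%:R ^+ i)).
    by rewrite natrX -exprM mulnC exprM -natrX.
  by rewrite lerXn2r ?nnegrE ?expR_ge0.
have q0 : 0 < (2 ^ i)%:R :> R by rewrite ltr0n expn_gt0.
rewrite -[leLHS]mulr_natr expRN ler_pdivlMr// mulrAC.
rewrite -mulrA ler_pdivrMl ?expR_gt0// !natrM.
by move: q4; rewrite !exprS expr0; lra.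
Qed.


End repeated.

(** * From pathwise to expected regret *)

Section regret_bound.
Variables (R : realType) (G : game R) (gstar : R -> pdf R).
Variables (L : set R) (D : R -> R -> R) (lbar : R).
Context d (Omega : measurableType d) (P : probability Omega R).
Variables (Y : nat -> Omega -> R * R) (g : nat -> Omega -> pdf R).
Variables (pi : policy R) (S : history R -> set R).
Hypothesis play : repeated_game G gstar pi P Y g.
Local Notation U := (induced_utility G gstar).
Local Notation Us := (best_utility G gstar L).
Local Notation al v := (accept_prob G gstar v).
Local Notation e := (eta_ G pi Y).
Hypothesis L_nonempty : L !=set0.
Hypothesis zoom : forall h, [/\ activation L D lbar S h, S h (pi h) &
  forall v, S h v ->
    zoom_index (Ffun G) lbar h v <= zoom_index (Ffun G) lbar h (pi h)].
Hypothesis best : forall v, L v -> worst_best_response G v (gstar v).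
Hypothesis U01 : forall v, L v -> 0 <= U v <= 1.
Hypothesis metricD : is_metric_on L D.
Hypothesis U_lip : forall v w, L v -> L w -> `|U v - U w| <= D v w.
Hypothesis D_le1 : forall v w, L v -> L w -> D v w <= 1.
Hypothesis lbar_ge1 : 1 <= lbar.
Hypothesis F_lip : forall v a a', L v -> 0 <= a <= 1 -> 0 <= a' <= 1 ->
  `|Ffun G v a - Ffun G v a'| <= lbar * `|a - a'|.
Variables (Cz dz : R).
Hypothesis Cz_gt0 : 0 < Cz.
Hypothesis dz_ge0 : 0 <= dz.
Hypothesis zdim : zooming_dimension L D (gap G gstar L) Cz dz.

Let gmax : R := Cz `^ (dz + 2%:R)^-1.

Let U_image_sup : has_sup (U @` L).
Proof.
split; first by have [v Lv] := L_nonempty; exists (U v), v.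
by exists 1 => _ [v Lv <-]; case/andP: (U01 Lv).
Qed.

Lemma le_best_utility v : L v -> U v <= Us.
Proof. by move=> Lv; apply: ub_le_sup; [exact: U_image_sup.2|exists v]. Qed.

Lemma best_utility_le1 : Us <= 1.
Proof.
apply: ge_sup; first exact: U_image_sup.1.
by move=> _ [v Lv <-]; case/andP: (U01 Lv).
Qed.

Lemma lt_best_utility r : r < Us -> exists2 v, L v & r < U v.
Proof. by move=> /(sup_gt U_image_sup.1)[_ [v Lv <-] rv]; exists v. Qed.

Let histS t w : hist G pi Y t.+1 w = rcons (hist G pi Y t w)
  (Round (pi (hist G pi Y t w)) (Y t w) (Z_ G pi Y t w)).
Proof. by []. Qed.

Lemma eta_in t w : L (e t w).
Proof.
exact: (@threshold_in R L D (Ffun G) lbar pi S (fun t => hist G pi Y t w)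
  (Y^~ w) (fun t => Z_ G pi Y t w) erefl (histS^~ w) zoom t).
Qed.

Lemma gap_ge0 t w : 0 <= gap G gstar L (e t w).
Proof. by rewrite subr_ge0 le_best_utility//; exact: eta_in. Qed.

Lemma gap_le1 t w : gap G gstar L (e t w) <= 1.
Proof.
have /andP[? _] := U01 (eta_in t w).
by have := best_utility_le1; rewrite /gap; lra.
Qed.

Lemma gap_le_gmax t w : gap G gstar L (e t w) <= gmax.
Proof.
exact: (gap_le_zooming_constant Cz_gt0 dz_ge0 zdim (eta_in t w) (gap_le1 t w)).
Qed.

Let pow2_gt1 i : (0 < i)%N -> (2 <= 2 ^ i)%N.
Proof. by move=> i0; rewrite -{1}(expn1 2) leq_exp2l. Qed.


Lemma clean_not_bad i w t : (0 < i)%N -> bad G gstar pi Y i w < 1 ->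
  (2 ^ i - 2 <= t < 2 ^ i.+1 - 2)%N ->
  clean L (fun t => hist G pi Y t w) (fun v => al v) t.
Proof.
move=> i0 not_bad /andP[at_ tb].
have i2 := pow2_gt1 i0.
have bE : (2 ^ i.+1 - 2 = 2 ^ i - 2 + 2 ^ i)%N by rewrite expnS; lia.
have phaseE : phase t = i.
  by apply: phase_eq; rewrite expnS; move: bE at_ tb; rewrite expnS; lia.
apply: (clean_no_deviation (y := Y^~ w) (z := fun t => Z_ G pi Y t w) erefl
  (histS^~ w)); first by move=> v _; exact: PA_ge0_le1.
rewrite /phase_start phaseE => s b /andP[a_s st].
set n := (\sum_(s <= r < t) _)%N => n_gt0.
rewrite leNgt; apply/negP => dev_n; move: not_bad; rewrite ltNge => /negP; apply.
have n_le : (n <= t - s)%N.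
  rewrite /n (leq_trans (leq_sum _ (fun r _ => leq_b1 _)))//.
  by rewrite sum_nat_const_nat muln1.
have s_lt : (s - (2 ^ i - 2) < 2 ^ i)%N by move: bE tb; lia.
have t_lt : (t - (2 ^ i - 2) < 2 ^ i)%N by move: bE tb; lia.
have n_lt : (n.-1 < 2 ^ i)%N by move: bE tb n_le n_gt0; lia.
pose j : dev_index i := (Ordinal s_lt, Ordinal t_lt, Ordinal n_lt, b).
(* A violated confidence bound puts [w] in the event [dev j], whose indicator alone brings [bad] up
   to 1. *)
rewrite /bad (bigD1 j)//= indicE mem_set; last first.
  rewrite /dev /= !subnKC ?(leq_trans a_s (ltnW st))// prednK//.
by rewrite lerDl; apply: sumr_ge0 => k _.
Qed.

Definition phase_bound (K i : nat) : R :=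
  (2 ^ i)%:R * 2 ^- K +
    288%:R * lbar ^+ 2 * i%:R * Cz * (2 ^- K) `^ (- dz) * 2 ^+ K.

Lemma phase_bound_ge0 K i : 0 <= phase_bound K i.
Proof.
apply: addr_ge0; first by rewrite mulr_ge0// invr_ge0 exprn_ge0.
apply: mulr_ge0; last by rewrite exprn_ge0.
apply: mulr_ge0; last exact: powR_ge0.
apply: mulr_ge0; last exact: ltW.
apply: mulr_ge0; last exact: ler0n.
by apply: mulr_ge0; [exact: ler0n|exact: sqr_ge0].
Qed.

(** If [bad] is below 1 the phase is clean. Otherwise [bad] is at least 1 and may multiply the crude
    bound, which gives a measurable majorant on all paths. *)
Lemma phase_regret_le K i w : (0 < i)%N ->
  \sum_(2 ^ i - 2 <= t < 2 ^ i.+1 - 2) gap G gstar L (e t w) <=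
  phase_bound K i + (2 ^ i)%:R * gmax * bad G gstar pi Y i w.
Proof.
move=> i0.
have gmax0 : 0 <= gmax by exact: powR_ge0.
have [bad1|not_bad] := leP 1 (bad G gstar pi Y i w).
  apply: (@le_trans _ _ ((2 ^ i)%:R * gmax)); last first.
    rewrite -[leLHS]add0r lerD ?phase_bound_ge0//.
    by rewrite -[leLHS]mulr1 ler_wpM2l// mulr_ge0.
  apply: (@le_trans _ _ (\sum_(2 ^ i - 2 <= t < 2 ^ i.+1 - 2) gmax)).
    by apply: ler_sum => t _; exact: gap_le_gmax.
  rewrite sumr_const_nat -[leLHS]mulr_natl.
  have -> : (2 ^ i.+1 - 2 - (2 ^ i - 2) = 2 ^ i)%N.
    by have := pow2_gt1 i0; rewrite expnS; lia.
  by [].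
have clean_i t := @clean_not_bad i w t i0 not_bad.
have phase_le := phase_gap_sum_le (h := fun t => hist G pi Y t w)
  (y := Y^~ w) (z := fun t => Z_ G pi Y t w) erefl (histS^~ w) zoom metricD
  D_le1 lbar_ge1 (fun v Lv => induced_utilityE (best Lv)) U01
  (fun v _ => PA_ge0_le1 _ _ _) U_lip F_lip le_best_utility lt_best_utility
  best_utility_le1 i0 clean_i Cz_gt0 dz_ge0 zdim K.
apply: le_trans phase_le _; rewrite lerDl.
by rewrite !mulr_ge0// bad_ge0.
Qed.

Lemma gap_sum_le (K T : nat) w : (0 < T)%N ->
  \sum_(t < T) gap G gstar L (e t w) <=
  \sum_(1 <= i < (trunc_log 2 T.+1).+1)
    (phase_bound K i + (2 ^ i)%:R * gmax * bad G gstar pi Y i w).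
Proof.
move=> T0; set I := trunc_log 2 T.+1.
have /andP[_ hi] := trunc_log_bounds (isT : (1 < 2)%N) (isT : (0 < T.+1)%N).
have TI : (T <= 2 ^ I.+1 - 2)%N by move: hi; rewrite -/I; lia.
(* The horizon is extended to the end of the phase of the last round, which is phase [I]; gaps are
   non-negative. *)
apply: (@le_trans _ _
    (\sum_(0 <= t < 2 ^ I.+1 - 2) gap G gstar L (e t w))).
  rewrite -(big_mkord xpredT (fun t => gap G gstar L (e t w))).
  rewrite (big_cat_nat (leq0n T) TI)/= lerDl.
  by apply: sumr_ge0 => t _; exact: gap_ge0.
rewrite sum_phases big_nat [leRHS]big_nat.
by apply: ler_sum => i /andP[i0 _]; exact: phase_regret_le.
Qed.

Lemma regret_ge0 T : (0 <= regret G gstar pi P Y L T)%E.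
Proof.
rewrite /regret unlock; apply: integral_ge0 => w _.
by rewrite lee_fin; apply: sumr_ge0 => t _; exact: gap_ge0.
Qed.

Lemma regret_le_horizon T : (regret G gstar pi P Y L T <= T%:R%:E)%E.
Proof.
rewrite /regret unlock.
apply: (@le_trans _ _ (\int[P]_w (cst T%:R%:E w))%E).
  apply: ge0_le_integral_pointwise => w.
    by rewrite lee_fin; apply: sumr_ge0 => t _; exact: gap_ge0.
  rewrite lee_fin -[leRHS]mulr1 mulr_natl -[X in _ <= _ *+ X]card_ord -sumr_const.
  by apply: ler_sum => t _; exact: gap_le1.
rewrite integral_cst//; apply: le_trans (lee_wpmul2l _ (probability_le1 P measurableT)) _.
  by rewrite lee_fin.
by rewrite mule1.
Qed.

(** The expectation of [bad] cancels the length [2^i] of the phase, so unclean behaviour costs at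
    most [2 gmax] per phase. Bounding [i] by [I] in each of the [I] phases produces the square. *)
Lemma regret_le_dyadic (K T : nat) : (0 < T)%N ->
  (regret G gstar pi P Y L T <= (2%:R * T%:R * 2 ^- K +
      288%:R * lbar ^+ 2 * (trunc_log 2 T.+1)%:R ^+ 2 * Cz *
        (2 ^- K) `^ (- dz) * 2 ^+ K +
      2%:R * (trunc_log 2 T.+1)%:R * gmax)%:E)%E.
Proof.
move=> T0; set I := trunc_log 2 T.+1; have gmax0 : 0 <= gmax by exact: powR_ge0.
pose B i w := phase_bound K i + (2 ^ i)%:R * gmax * bad G gstar pi Y i w.
have B0 i w : 0 <= B i w.
  by rewrite addr_ge0 ?phase_bound_ge0// !mulr_ge0// bad_ge0.
have mbad i : measurable_fun setT (bad G gstar pi Y i) by exact: measurable_bad play i.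
have mB i : measurable_fun setT (EFin \o B i).
  apply/measurable_EFinP; apply: measurable_funD => //.
  exact: measurable_funM.
rewrite /regret unlock.
apply: (@le_trans _ _ (\int[P]_w (\sum_(i <- index_iota 1 I.+1) (B i w)%:E))%E).
  apply: ge0_le_integral_pointwise => w.
    by rewrite lee_fin; apply: sumr_ge0 => t _; exact: gap_ge0.
  by rewrite sumEFin lee_fin; exact: gap_sum_le.
rewrite ge0_integral_sum; first last.
- by move=> i w _; rewrite lee_fin.
- exact: mB.
- by [].
apply: (@le_trans _ _ (\sum_(i <- index_iota 1 I.+1)
    ((2 ^ i)%:R * 2 ^- K +
    (288%:R * lbar ^+ 2 * I%:R * Cz * (2 ^- K) `^ (- dz) * 2 ^+ K +
     2%:R * gmax))%:E)%E).
  rewrite big_seq [leRHS]big_seq; apply: lee_sum => i.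
  rewrite mem_index_iota => /andP[i0 iI].
  have -> : (\int[P]_w (B i w)%:E = (phase_bound K i)%:E +
      ((2 ^ i)%:R * gmax)%:E * \int[P]_w (bad G gstar pi Y i w)%:E)%E.
    under eq_integral do rewrite EFinD [X in (_ + X)%E]EFinM.
    rewrite ge0_integralD; first last.
    - by apply: emeasurable_funM => //; exact/measurable_EFinP.
    - by move=> w _; rewrite -EFinM lee_fin !mulr_ge0// bad_ge0.
    - by [].
    - by move=> w _; rewrite lee_fin phase_bound_ge0.
    - by [].
    congr (_ + _)%E.
      rewrite integral_cst// -[RHS]mule1; congr (_ * _)%E.
      exact: probability_setT.
    rewrite ge0_integralZl//; last by rewrite lee_fin mulr_ge0.
    - exact/measurable_EFinP.
    - by move=> w _; rewrite lee_fin bad_ge0.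
  have i2 : 0 < (2 ^ i)%:R :> R by rewrite ltr0n expn_gt0.
  apply: (@le_trans _ _ ((phase_bound K i)%:E + ((2 ^ i)%:R * gmax)%:E *
      (2%:R / (2 ^ i)%:R)%:E)%E).
    apply: leeD2l; apply: lee_wpmul2l; last exact: (integral_bad_le play i0).
    by rewrite lee_fin; apply: mulr_ge0 => //; exact: ler0n.
  rewrite -EFinM -EFinD lee_fin /phase_bound -!addrA lerD2l; apply: lerD; last first.
    rewrite le_eqVlt; apply/orP; left; apply/eqP.
    by move: (2 ^ i)%:R i2 => q q0; field; rewrite gt_eqF.
  apply: ler_wpM2r; first by rewrite exprn_ge0.
  apply: ler_wpM2r; first exact: powR_ge0.
  apply: ler_wpM2r; first exact: ltW.
  apply: ler_wpM2l; first by apply: mulr_ge0; [exact: ler0n|exact: sqr_ge0].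
  by rewrite ler_nat -ltnS.
rewrite sumEFin lee_fin big_split/= -mulr_suml -natr_sum sum_pow2.
rewrite sumr_const_nat subn1 /= -[X in _ + X]mulr_natl.
have TI : (2 ^ I.+1 - 2 <= 2 * T)%N.
  have /andP[lo _] := trunc_log_bounds (isT : (1 < 2)%N) (isT : (0 < T.+1)%N).
  by move: lo; rewrite -/I expnS; lia.
rewrite -addrA; apply: lerD.
  by rewrite -natrM ler_wpM2r ?invr_ge0 ?exprn_ge0// ler_nat.
rewrite mulrDr; apply: lerD; last by rewrite mulrCA mulrA.
by rewrite le_eqVlt; apply/orP; left; apply/eqP; ring.
Qed.

End regret_bound.


Theorem theorem1 (R : realType) :
  exists2 C : R, 0 < C &
  forall (G : game R) (etamin etamax : R) (gstar : R -> pdf R)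
    (D : R -> R -> R) (l Cz dz : R) (pi : policy R)
    (d : measure_display) (Omega : measurableType d) (P : probability Omega R)
    (Y : nat -> Omega -> R * R) (g : nat -> Omega -> pdf R),
  let L : set R := `[etamin, etamax]%classic in
  let U := induced_utility G gstar in
  let F := Ffun G in
  let lbar : R := Num.max 1 l in
  2%:R <= etamin -> etamin < etamax ->
  (forall eta, L eta -> worst_best_response G eta (gstar eta)) ->
  (forall eta, L eta -> 0 <= U eta <= 1) ->
  is_metric_on L D ->
  (forall eta eta', L eta -> L eta' -> `|U eta - U eta'| <= D eta eta') ->
  (forall eta eta', L eta -> L eta' -> D eta eta' <= 1) ->
  (forall eta a a', L eta -> 0 <= a <= 1 -> 0 <= a' <= 1 ->
     `|F eta a - F eta a'| <= l * `|a - a'|) ->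
  0 < Cz -> 0 <= dz ->
  zooming_dimension L D (gap G gstar L) Cz dz ->
  zooming_policy L D F lbar pi ->
  repeated_game G gstar pi P Y g ->
  forall T : nat, (2 <= T)%N ->
  (regret G gstar pi P Y L T <=
     (C * ((Cz * lbar ^+ 2 * (ln T%:R) ^+ 2) `^ (dz + 2%:R)^-1
           * T%:R `^ ((dz + 1) / (dz + 2%:R))))%:E)%E.
Proof.
exists 5000%:R; first by rewrite ltr0n.
move=> G etamin etamax gstar D l Cz dz pi d Omega P Y g L U F lbar.
move=> _ eta_lt best U01 metricD U_lip D_le1 F_lip Cz0 dz0 zdim [S zoom] play.
move=> T T2.
have lbar1 : 1 <= lbar by rewrite le_max lexx.
have L0 : L !=set0 by exists etamin; rewrite /L /= in_itv/= lexx ltW.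
have F_lip' v a a' : L v -> 0 <= a <= 1 -> 0 <= a' <= 1 ->
    `|F v a - F v a'| <= lbar * `|a - a'|.
  move=> Lv a01 a'01; apply: le_trans (F_lip v a a' Lv a01 a'01) _.
  by rewrite ler_wpM2r// le_max lexx orbT.
have T0 : (0 < T)%N by exact: ltnW.
have dyadic K := regret_le_dyadic play L0 zoom best U01 metricD U_lip D_le1
  lbar1 F_lip' Cz0 dz0 zdim K T0.
have reg0 := regret_ge0 P Y L0 zoom U01 T.
have regT := regret_le_horizon P Y L0 zoom U01 T.
(* Finiteness moves the bounds from extended reals to reals, where [regret_rate] applies. *)
have reg_fin : regret G gstar pi P Y L T \is a fin_num.
  by rewrite ge0_fin_numE// (le_lt_trans regT)// ltry.
rewrite -(fineK reg_fin) lee_fin.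
apply: (regret_rate Cz0 dz0 lbar1 T2 (lexx _)).
  by rewrite -lee_fin fineK.
by move=> K; rewrite -lee_fin fineK//; exact: dyadic.
Qed.
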